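(* Let $X,Y$ be pointed metric spaces, $1\le s\le\infty$, $0<p\le s\le\infty$ and $0<r\le p$. If $S:X\to Y$ is a Lipschitz map such that $T\circ S\in\Pi^L_{(p,\mathfrak{m}^L(r;r))}(X,F)$ for every Banach space $F$ and every $T\in\Pi^L_{(p,\mathfrak{m}^L(s;p))}(Y,F)$, then $S\in\Pi^L_{(\mathfrak{m}^L(s;p),r)}(X,Y)$. Moreover $$\pi^L_{(\mathfrak{m}^L(s;p),r)}(S)=\sup_{F\text{ Banach space}}\left\{\pi^L_{(p,\mathfrak{m}^L(r;r))}(T\circ S):T\in\Pi^L_{(p,\mathfrak{m}^L(s;p))}(Y,F),\ \pi^L_{(p,\mathfrak{m}^L(s;p))}(T)\le1\right\}.$$
   Context: For a metric space $X$ with base point $x_0$, $X^{\#}$ is the Banach space of real-valued Lipschitz functions on $X$ vanishing at $x_0$, with norm $Lip(\cdot)$ (the Lipschitz constant); $B_{X^{\#}}$ is its closed unit ball. $(\sigma,x',x'')$ denotes a finite sequence $(\sigma_j,x'_j,x''_j)_{j=1}^m$ in $\mathbb{R}\times X\times X$. Indices lie in $(0,\infty]$, $1/\infty=0$. Put $\|(\sigma,x',x'')|\ell_p\|=\big[\sum_j|\sigma_j|^p d_X(x'_j,x''_j)^p\big]^{1/p}$ and $\|(\sigma,x',x'')|\ell_p^{L,w}\|=\sup_{f\in B_{X^{\#}}}\big[\sum_j|\sigma_j|^p|f(x'_j)-f(x''_j)|^p\big]^{1/p}$ (sums replaced by suprema over $j$ if $p=\infty$). For $0<q\le s\le\infty$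 let $s'(q)\in(0,\infty]$ be given by $\frac1{s'(q)}+\frac1s=\frac1q$, and put $\mathfrak{m}^L_{(s;q)}(\sigma,x',x'')=\inf_\tau\|\tau|\ell_{s'(q)}\|\,\|(\sigma/\tau,x',x'')|\ell_s^{L,w}\|$, the infimum over all $\tau=(\tau_j)$ with $\tau_j\in\mathbb{R}\setminus\{0\}$, where $\sigma/\tau=(\sigma_j/\tau_j)_j$. In particular $\mathfrak{m}^L_{(s;s)}(\sigma,x',x'')=\|(\sigma,x',x'')|\ell_s^{L,w}\|$. For $p\le q\le s$, a Lipschitz map $T:X\to Y$ is Lipschitz $(\mathfrak{m}^L(s;q),p)$-summing if there is $C\ge0$ with $\mathfrak{m}^L_{(s;q)}(\sigma,Tx',Tx'')\le C\,\|(\sigma,x',x'')|\ell_p^{L,w}\|$ for all finite sequences $(\sigma,x',x'')$; $\Pi^L_{(\mathfrak{m}^L(s;q),p)}(X,Y)$ is the class of all such maps and $\pi^L_{(\mathfrak{m}^L(s;q),p)}(T)$ is the infimum of such $C$. For $q\le s$ and $p\ge q$, a Lipschitz map $T:X\to Y$ is Lipschitz $(p,\mathfrak{m}^L(s;q))$-summing if there is $C\ge0$ with $\|(\sigma,Tx',Tx'')|\ell_p\|\le C\,\mathfrak{m}^L_{(s;q)}(\sigma,x',x'')$ for all finite sequences; $\Pi^L_{(p,\mathfrak{m}^L(s;q))}(X,Y)$ is the class of all such maps and $\pi^L_{(p,\mathfrak{m}^L(s;q))}(T)$ is the infimum of such $C$. A Banach space is regarded as a metric space with its norm distance. *)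

(* Defs.v *)
From HB Require Import structures.
From mathcomp Require Import all_boot all_order all_algebra.
From mathcomp Require Import all_classical all_reals all_analysis.

Set Implicit Arguments.
Unset Strict Implicit.
Unset Printing Implicit Defensive.
Import Order.TTheory GRing.Theory Num.Theory.
Import numFieldNormedType.Exports.
Local Open Scope classical_set_scope.
Local Open Scope ring_scope.

(** A normed space as a metric space. The library has no instance of
    [metricType] on an abstract [normedModType]. *)
Section normed_metric.
Context {R : realType} (F : normedModType R).

Let dist (x y : F) : R := `|x - y|.

Let dist_ge0 x y : 0 <= dist x y. Proof. exact: normr_ge0. Qed.

Let dist_positivity x y : dist x y = 0 -> x = y.
Proof. by move/normr0_eq0/subr0_eq. Qed.

Let ball_dist (x : F) (d : R) : ball x d = [set y | dist x y < d].
Proof. by rewrite -ball_normE. Qed.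

Definition normed_metric : metricType R :=
  HB.pack (NormedModule.sort F)
    (@PseudoMetric_isMetric.Build R F dist dist_ge0 dist_positivity ball_dist).

Lemma normed_metricE (x y : normed_metric) :
  mdist x y = `|(x : F) - (y : F)|.
Proof. by []. Qed.

End normed_metric.

Section lipschitz.
Context {R : realType} {X Y : metricType R}.

Definition lipschitz_const (f : X -> Y) : set R :=
  [set k | 0 <= k /\ forall x y, mdist (f x) (f y) <= k * mdist x y].

Definition lipschitz_map (f : X -> Y) : Prop := lipschitz_const f !=set0.

Definition Lip (f : X -> Y) : \bar R := ereal_inf (EFin @` lipschitz_const f).

Lemma Lip_le1P (f : X -> Y) :
  lipschitz_map f /\ (Lip f <= 1)%E <->
  forall x y, mdist (f x) (f y) <= mdist x y.
Proof.
split=> [[_ L] x y|h].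
  have [->|xy] := eqVneq x y; first by rewrite !mdistxx.
  have d0 : 0 < mdist x y by rewrite mdist_gt0.
  rewrite -[leRHS]mul1r -ler_pdivrMr// -lee_fin (le_trans _ L)//.
  apply: le_ereal_inf_tmp => _ [k [_ hk] <-].
  by rewrite lee_fin ler_pdivrMr.
have h1 : lipschitz_const f 1 by split=> // x y; rewrite mul1r.
by split; [exists 1|apply: ereal_inf_lbound; exists 1].
Qed.

End lipschitz.

(** The dual [X^#]; the metric structure of the real line is that of [R^o]. *)
Definition lip_dual {R : realType} {X : metricType R} (x0 : X) :
    set (X -> R) :=
  [set f | lipschitz_map (f : X -> R^o) /\ f x0 = 0].

Definition lip_dual_ball {R : realType} {X : metricType R} (x0 : X) :
    set (X -> R) :=
  [set f | lip_dual x0 f /\ (Lip (f : X -> R^o) <= 1)%E].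

(** Exponents range over [0 < p <= +oo]; the value at [-oo] is junk. *)
Definition lpnorm {R : realType} (p : \bar R) m (a : 'I_m -> R) : R :=
  match p with
  | p%:E => (\sum_(j < m) `|a j| `^ p) `^ p^-1
  | +oo%E => \big[Num.max/0]_(j < m) `|a j|
  | -oo%E => 0
  end.

Section sequence_norms.
Context {R : realType} {X : metricType R}.

Definition strong_norm (p : \bar R) m (sigma : 'I_m -> R) (x' x'' : 'I_m -> X) :
    \bar R :=
  (lpnorm p (fun j => sigma j * mdist (x' j) (x'' j)))%:E.

Definition weak_norm (x0 : X) (p : \bar R) m (sigma : 'I_m -> R)
    (x' x'' : 'I_m -> X) : \bar R :=
  ereal_sup [set (lpnorm p (fun j => sigma j * (f (x' j) - f (x'' j))))%:E
            | f in lip_dual_ball x0].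

(** The solution [s'(q)] of [1/s'(q) + 1/s = 1/q]; in [\bar R] one has
    [+oo^-1 = 0] and [0^-1 = +oo]. *)
Definition mixed_conj (s q : \bar R) : \bar R := ((q^-1 - s^-1)^-1)%E.

Definition mixed_norm (x0 : X) (s q : \bar R) m (sigma : 'I_m -> R)
    (x' x'' : 'I_m -> X) : \bar R :=
  ereal_inf [set ((lpnorm (mixed_conj s q) tau)%:E *
                  weak_norm x0 s (fun j => sigma j / tau j)%R x' x'')%E
            | tau in [set tau : 'I_m -> R | forall j, tau j != 0]].

End sequence_norms.

Lemma mixed_conjP {R : realType} (s q : \bar R) :
  (0 < q -> q <= s ->
   0 < mixed_conj s q /\ (mixed_conj s q)^-1 + s^-1 = q^-1)%E.
Proof.
move=> q0 qs; have s0 : (0 < s)%E := lt_le_trans q0 qs.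
rewrite /mixed_conj inveK.
have sfin : s^-1%E \is a fin_num.
  by case: s s0 {qs} => [s||]//; rewrite lte_fin => s0; rewrite inver gt_eqF.
split; last by rewrite subeK.
have : (0 <= q^-1 - s^-1)%E.
  by rewrite sube_ge0 ?sfin// lee_pV2// ?inE ltW.
rewrite le_eqVlt => /orP[/eqP <-|]; first by rewrite inve0.
move=> d0; suff dy : (q^-1 - s^-1 < +oo)%E.
  by rewrite inve_gt0//; [rewrite gt_eqF|rewrite lt_eqF].
have : (q^-1 < +oo)%E.
  by case: q q0 {qs d0} => [q||]//; rewrite lte_fin => q0; rewrite inver gt_eqF// ltry.
move=> qy; move: qy d0 sfin.
by case: (q^-1)%E => [?||]//; case: (s^-1)%E => [?||]// _ _ _; rewrite ltry.
Qed.

(** [T] is Lipschitz [(m^L(s;q), p)]-summing, for [p <= q <= s]. *)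
Section mixed_summing.
Context {R : realType} {X Y : metricType R} (x0 : X) (y0 : Y).
Variables s q p : \bar R.

Definition mixed_summing_const (T : X -> Y) : set R :=
  [set C | 0 <= C /\
    forall m (sigma : 'I_m -> R) (x' x'' : 'I_m -> X),
      (mixed_norm y0 s q sigma (T \o x') (T \o x'') <=
       C%:E * weak_norm x0 p sigma x' x'')%E].

Definition mixed_summing : set (X -> Y) :=
  [set T | lipschitz_map T /\ mixed_summing_const T !=set0].

Definition mixed_summing_norm (T : X -> Y) : \bar R :=
  ereal_inf (EFin @` mixed_summing_const T).

End mixed_summing.

(** [T] is Lipschitz [(p, m^L(s;q))]-summing, for [q <= s] and [q <= p]. *)
Section summing_mixed.
Context {R : realType} {X Y : metricType R} (x0 : X).
Variables p s q : \bar R.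

Definition summing_mixed_const (T : X -> Y) : set R :=
  [set C | 0 <= C /\
    forall m (sigma : 'I_m -> R) (x' x'' : 'I_m -> X),
      (strong_norm p sigma (T \o x') (T \o x'') <=
       C%:E * mixed_norm x0 s q sigma x' x'')%E].

Definition summing_mixed : set (X -> Y) :=
  [set T | lipschitz_map T /\ summing_mixed_const T !=set0].

Definition summing_mixed_norm (T : X -> Y) : \bar R :=
  ereal_inf (EFin @` summing_mixed_const T).

End summing_mixed.

(* Main.v *)
From HB Require Import structures.
Require Import Defs.
From mathcomp Require Import all_boot all_order all_algebra.
From mathcomp Require Import all_classical all_reals all_analysis.
From mathcomp Require Import ring lra.
Set Implicit Arguments.
Unset Strict Implicit.
Unset Printing Implicit Defensive.
Import Order.TTheory GRing.Theory Num.Theory.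
Import numFieldNormedType.Exports.
Local Open Scope classical_set_scope.
Local Open Scope ring_scope.

(** The proof rests on a dual description of the mixed norm. Let [d] be the
    distance of [Y]. Call a pseudometric [rho] on [Y] weakly dominated (for the
    exponent [s]) if the [l_s] norm of [sigma_j * rho (y'_j, y''_j)] never
    exceeds the weak [l_s] norm of [(sigma, y', y'')]. Examples are
    [|f y - f z|] with [f] in the unit ball of the Lipschitz dual, the [l_s]
    means of such functions, and, for [s = +oo], [d] itself.

    Duality: [m_(s;p)(sigma, y', y'')] is the supremum, over the weakly
    dominated [rho], of the [l_p] norm of [sigma_j * rho (y'_j, y''_j)]. One
    inequality is Hoelder's ([lpnorm_le_mixed_norm]). For the other
    ([mixed_norm_le_dominated]) with [p < s < +oo], Minkowski's inequality in
    the plane makes the set of vectors [v_j = |sigma_j rho_j|^s] convex. At a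
    maximizer [v] of the concave function [\sum_j v_j^(p/s)] the first-order
    condition says that the linear form with coefficients [v_j^(p/s-1)] takes
    its largest value on the set at [v]; this is precisely the statement that
    [tau_j = v_j^((1-p/s)/s)] is an optimal factor in the definition of the
    mixed norm. The set may fail to be closed, so the argument is run, up to
    an error, at a point that almost maximizes ([near_maximizer_weights]).

    Realization: a pseudometric [rho] on [Y] is the distance induced by the
    Kuratowski map [y |-> rho(y, .) - rho(y0, .)] into a Banach space of
    bounded functions, and if [rho] is weakly dominated then by the easy half of
    the duality this map is [(p, m(s;p))]-summing with constant 1. Feeding it
    into the hypothesis bounds the [l_p] norm of
    [sigma_j * rho (S x'_j, S x''_j)] by a multiple of the weak [l_r] norm of
    [(sigma, x', x'')]; taking the supremum over [rho], the hard half of the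
    duality bounds [m_(s;p)(sigma, S x', S x'')]. When the supremum on the
    right-hand side of the equality is finite, it is itself such a multiple;
    this gives the inequality of norms that is not a mere composition.

    Uniformity in [rho]: that some multiple serves all [rho] at once is a
    gliding hump argument ([bounds_pseudometrics_exists]). If none did,
    pseudometrics [rho_n] violating the bounds [n * 2^((n+1)/s)] could be
    packed, with weights [2^(-(n+1)/s)], into the distance of a single map
    ([absorb_pseudometrics]), whose composite with [S] would not be summing. *)

(** * The Banach space of bounded functions *)

Section bounded_functions.
Context {R : realType} (I : Type).

Definition is_bounded : {pred I -> R^o} :=
  [pred f | `[< exists M : R, forall i, `|f i| <= M >]].

Lemma is_boundedP (f : I -> R^o) :
  reflect (exists M : R, forall i, `|f i| <= M) (f \in is_bounded).
Proof. exact: asboolP. Qed.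

Lemma is_bounded_submod_closed : submod_closed is_bounded.
Proof.
split=> [|a f g /is_boundedP[M fM] /is_boundedP[N gN]]; apply/is_boundedP.
  by exists 0 => i; rewrite normr0.
exists (`|a| * M + N) => i.
rewrite (le_trans (ler_normD _ _))// lerD// normrM.
exact: ler_wpM2l.
Qed.

HB.instance Definition _ :=
  GRing.isSubmodClosed.Build _ _ is_bounded is_bounded_submod_closed.

Record bfun := BFun { bfun_fun :> I -> R^o; bfunP : bfun_fun \in is_bounded }.

HB.instance Definition _ := [isSub for bfun_fun].
HB.instance Definition _ := [Choice of bfun by <:].
HB.instance Definition _ := [SubChoice_isSubLmodule of bfun by <:].

Implicit Types f g : bfun.

Definition bfun_norm f : R := sup (range (fun i => `|f i|)).

Lemma bfun_norm_ub f i : `|f i| <= bfun_norm f.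
Proof.
apply: ub_le_sup; last by exists i.
by have /is_boundedP[M fM] := bfunP f; exists M => _ [j _ <-].
Qed.

Lemma bfun_norm_le f (M : R) : 0 <= M -> (forall i, `|f i| <= M) ->
  bfun_norm f <= M.
Proof.
move=> M0 fM; rewrite /bfun_norm.
have [->|/set0P ne] := eqVneq (range (fun i => `|f i|)) set0.
  by rewrite sup0.
by apply: ge_sup => // _ [j _ <-].
Qed.

Lemma bfun_norm_ge0 f : 0 <= bfun_norm f.
Proof.
rewrite /bfun_norm.
have [->|/set0P[_ [i _ _]]] := eqVneq (range (fun i => `|f i|)) set0.
  by rewrite sup0.
exact: le_trans (bfun_norm_ub f i).
Qed.

Lemma bfun_normD f g : bfun_norm (f + g) <= bfun_norm f + bfun_norm g.
Proof.
apply: bfun_norm_le => [|i]; first by rewrite addr_ge0// bfun_norm_ge0.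
by rewrite (le_trans (ler_normD _ _))// lerD// bfun_norm_ub.
Qed.

Lemma bfun_normZ_le (a : R) f : bfun_norm (a *: f) <= `|a| * bfun_norm f.
Proof.
apply: bfun_norm_le => [|i]; first by rewrite mulr_ge0// bfun_norm_ge0.
by rewrite [X in X <= _]normrM ler_wpM2l// bfun_norm_ub.
Qed.

Lemma bfun_normZ (a : R) f : bfun_norm (a *: f) = `|a| * bfun_norm f.
Proof.
apply/eqP; rewrite eq_le bfun_normZ_le/=.
have [->|a0] := eqVneq a 0; first by rewrite normr0 mul0r bfun_norm_ge0.
rewrite -ler_pdivlMl ?normr_gt0// -normfV.
by rewrite (le_trans _ (bfun_normZ_le _ _))// scalerK.
Qed.

Lemma bfun_norm0_eq0 f : bfun_norm f = 0 -> f = 0.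
Proof.
move=> f0; apply/val_inj/funext => i; apply/eqP.
by rewrite -normr_le0 -f0 bfun_norm_ub.
Qed.

HB.instance Definition _ :=
  Lmodule_isNormed.Build R bfun bfun_normD bfun_normZ bfun_norm0_eq0.

(** A Cauchy filter converges pointwise because [R] is complete; the Cauchy
    estimate is uniform in the argument and survives the pointwise limit. *)
Lemma bfun_cauchy_cvg (F : set_system bfun) : ProperFilter F ->
  cauchy F -> cvg F.
Proof.
move=> FF /cauchyP Fc.
have {}Fc (e : R) : 0 < e ->
    exists f, F [set h : bfun | forall i, `|f i - h i| <= e].
  move=> /Fc[f Ff]; exists f; apply: filterS Ff => h.
  rewrite -ball_normE/= => /ltW fh i.
  exact: le_trans (bfun_norm_ub (f - h) i) fh.
pose ev i (f : bfun) : R^o := f i.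
have evc i : cvg (ev i @ F).
  apply: (@cauchy_cvg R^o); apply/cauchy_exP => e e0.
  have [f fF] := Fc (e / 2) (divr_gt0 e0 (ltr0n _ 2)).
  have e2 : e / 2 < e by rewrite ltr_pdivrMr// mulr_natr mulr2n ltrDl.
  exists (f i); suff : F [set h : bfun | ball (f i) e (h i)] by [].
  apply: filterS fF => h fh.
  by rewrite /= -ball_normE/=; exact: le_lt_trans (fh i) e2.
pose g i : R^o := lim (ev i @ F).
have gF i (e : R) : 0 < e -> F [set h : bfun | `|g i - h i| <= e].
  by move=> e0; have /cvgrPdist_le := evc i; exact.
have fg (e : R) f : (F [set h : bfun | forall i, `|f i - h i| <= e]) ->
    forall i, `|f i - g i| <= e.
  move=> fF i; apply/ler_addgt0Pr => d d0.
  have [h [fh gh]] := filter_ex (filterI fF (gF i d d0)).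
  by rewrite (le_trans (ler_distD (h i) _ _))// lerD// distrC.
have gb : g \in is_bounded.
  have [f /fg fg1] := Fc 1 ltr01; apply/is_boundedP.
  exists (1 + `|f|) => i.
  rewrite -[g i](subrK (f i)) (le_trans (ler_normD _ _))//.
  by rewrite lerD ?bfun_norm_ub// distrC.
apply/cvg_ex; exists (BFun gb); apply/cvgrPdist_le => e e0.
have [f fF] := Fc (e / 2) (divr_gt0 e0 (ltr0n _ 2)).
apply: filterS (fF) => h fh; apply: bfun_norm_le => [|i]; first exact: ltW.
rewrite [e]splitr.
rewrite (le_trans (ler_distD (f i) _ _))// lerD//.
by rewrite distrC; exact: fg.
Qed.

HB.instance Definition _ := Uniform_isComplete.Build bfun bfun_cauchy_cvg.
End bounded_functions.

(** * Inequalities for real powers *)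

Section powR_inequalities.
Context {R : realType}.
Implicit Types A B x y t th s : R.

Lemma weighted_amgm th x y : 0 < th < 1 -> 0 <= x -> 0 <= y ->
  x `^ th * y `^ (1 - th) <= th * x + (1 - th) * y.
Proof.
move=> /andP[th0 th1] x0 y0; have th1' : 0 < 1 - th by rewrite subr_gt0.
have := @conjugate_powR _ (x `^ th) (y `^ (1 - th)) th^-1 (1 - th)^-1.
rewrite !powR_ge0 !invr_gt0 !invrK -!powRrM !mulfV ?gt_eqF// !powRr1//.
by rewrite subrKC (mulrC _ th) (mulrC _ (1 - th)); apply.
Qed.

(** Concavity of [x `^ th]: its graph lies below the tangent at [y]. This is
    weighted AM-GM divided by [y `^ (1 - th)]. *)
Lemma powR_tangent th x y : 0 < th < 1 -> 0 <= x -> 0 < y ->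
  x `^ th <= y `^ th + th * (y `^ (th - 1) * (x - y)).
Proof.
move=> th01 x0 y0.
have yE : y `^ th = y `^ (th - 1) * y.
  by rewrite mulrC mulr_powRB1 ?ltW//; case/andP: th01.
have -> : y `^ th + th * (y `^ (th - 1) * (x - y)) =
    y `^ (th - 1) * (th * x + (1 - th) * y) by rewrite yE; ring.
have -> : x `^ th = y `^ (th - 1) * (x `^ th * y `^ (1 - th)).
  rewrite mulrCA -powRD ?(gt_eqF y0) ?implybT//.
  by rewrite subrKA subrr powRr0 mulr1.
by rewrite ler_wpM2l ?powR_ge0// weighted_amgm// ltW.
Qed.

Lemma powR_antimono (r x y : R) : r <= 0 -> 0 < x -> x <= y -> y `^ r <= x `^ r.
Proof.
move=> r0 x0 xy; have y0 := lt_le_trans x0 xy.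
rewrite -[r]opprK (powRN y) (powRN x) lef_pV2 ?posrE ?powR_gt0//.
by apply: ge0_ler_powR; rewrite ?nnegrE ?oppr_ge0 ?(ltW x0) ?(ltW y0).
Qed.

Lemma powR_subadd th x y : 0 < th <= 1 -> 0 <= x -> 0 <= y ->
  (x + y) `^ th <= x `^ th + y `^ th.
Proof.
move=> /andP[th0 th1] x0 y0.
have [xy0|xy0] := eqVneq (x + y) 0.
  by rewrite xy0 powR0 ?gt_eqF// addr_ge0 ?powR_ge0.
have xy1 : 0 < x + y by rewrite lt0r xy0 addr_ge0.
have le1 z : 0 <= z -> z <= x + y -> z * (x + y) `^ (th - 1) <= z `^ th.
  rewrite le0r => /predU1P[-> _|z0 zxy]; first by rewrite mul0r powR_ge0.
  rewrite -[in leRHS](mulr_powRB1 (ltW z0) th0) ler_wpM2l ?(ltW z0)//.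
  by apply: powR_antimono => //; rewrite subr_le0.
rewrite -[leLHS](mulr_powRB1 (ltW xy1) th0) mulrDl lerD// le1//.
  by rewrite lerDl.
by rewrite lerDr.
Qed.

(** Weighted AM-GM, summed after normalizing both sums to 1. *)
Lemma hoelder_sum th m (a b : 'I_m -> R) : 0 < th < 1 ->
  (forall j, 0 <= a j) -> (forall j, 0 <= b j) ->
  \sum_j a j `^ th * b j `^ (1 - th) <=
  (\sum_j a j) `^ th * (\sum_j b j) `^ (1 - th).
Proof.
move=> th01 a0 b0; have /andP[th0 th1] := th01.
have th1' : 0 < 1 - th by rewrite subr_gt0.
set A := \sum_j a j; set B := \sum_j b j.
have A0 : 0 <= A by rewrite sumr_ge0.
have B0 : 0 <= B by rewrite sumr_ge0.
have [AE|An0] := eqVneq A 0.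
  rewrite big1 ?mulr_ge0 ?powR_ge0// => j _.
  have := psumr_eq0P (fun i _ => a0 i) AE => /(_ j isT) ->.
  by rewrite powR0 ?mul0r// gt_eqF.
have [BE|Bn0] := eqVneq B 0.
  rewrite big1 ?mulr_ge0 ?powR_ge0// => j _.
  have := psumr_eq0P (fun i _ => b0 i) BE => /(_ j isT) ->.
  by rewrite (powR0 (_ : 1 - th != 0)) ?mulr0// gt_eqF.
have Ap : 0 < A by rewrite lt0r An0.
have Bp : 0 < B by rewrite lt0r Bn0.
have abE j : a j `^ th * b j `^ (1 - th) =
    A `^ th * B `^ (1 - th) * ((a j / A) `^ th * (b j / B) `^ (1 - th)).
  have -> : a j `^ th = (a j / A) `^ th * A `^ th.
    by rewrite -powRM ?divr_ge0// divfK.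
  have -> : b j `^ (1 - th) = (b j / B) `^ (1 - th) * B `^ (1 - th).
    by rewrite -powRM ?divr_ge0// divfK.
  by ring.
under eq_bigr do rewrite abE.
rewrite -mulr_sumr ler_piMr ?mulr_ge0 ?powR_ge0//.
apply: (@le_trans _ _ (\sum_j (th * (a j / A) + (1 - th) * (b j / B)))).
  by apply: ler_sum => j _; rewrite weighted_amgm ?divr_ge0.
rewrite big_split/= -!mulr_sumr -!mulr_suml divff// divff// !mulr1.
by rewrite subrKC.
Qed.

Lemma powR_convex t s x y : 0 <= t <= 1 -> 1 <= s -> 0 <= x -> 0 <= y ->
  (t * x + (1 - t) * y) `^ s <= t * x `^ s + (1 - t) * y `^ s.
Proof.
move=> /andP[t0 t1] s1 x0 y0.
have := @convex_powR R s s1 (Itv01 t0 t1) x y.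
rewrite !inE/= !in_itv/= !andbT => /(_ x0 y0).
by rewrite !convRE.
Qed.

(** The weighted [l_s] mean of two numbers. Applied to distances, it plays the
    role of averaging the [s]-th powers over a probability measure. *)
Definition powmix t s x y : R := (t * x `^ s + (1 - t) * y `^ s) `^ s^-1.

Lemma powmix_ge0 t s x y : 0 <= powmix t s x y.
Proof. exact: powR_ge0. Qed.

Lemma powmixK t s x y : 0 <= t <= 1 -> 1 <= s ->
  powmix t s x y `^ s = t * x `^ s + (1 - t) * y `^ s.
Proof.
move=> /andP[t0 t1] s1; have s0 : 0 < s := lt_le_trans ltr01 s1.
rewrite /powmix -powRrM mulVf ?gt_eqF// powRr1//.
by rewrite addr_ge0// mulr_ge0 ?powR_ge0// subr_ge0.
Qed.

Lemma powR_rootK s x : 0 < s -> 0 <= x -> (x `^ s^-1) `^ s = x.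
Proof. by move=> s0 x0; rewrite -powRrM mulVf ?gt_eqF// powRr1. Qed.

Lemma powR_Kroot s x : 0 < s -> 0 <= x -> (x `^ s) `^ s^-1 = x.
Proof. by move=> s0 x0; rewrite -powRrM mulfV ?gt_eqF// powRr1. Qed.

Lemma le_powR_root s x u : 0 < s -> 0 <= x -> 0 <= u ->
  (u <= x `^ s^-1) = (u `^ s <= x).
Proof.
move=> s0 x0 u0; apply/idP/idP => h.
  rewrite -(powR_rootK s0 x0).
  by rewrite ge0_ler_powR ?nnegrE ?powR_ge0// ltW.
rewrite -(powR_Kroot s0 u0).
by rewrite ge0_ler_powR ?nnegrE ?powR_ge0 ?invr_ge0// ltW.
Qed.

Lemma powR_normM s x u : 0 <= u -> `|x * u| `^ s = `|x| `^ s * u `^ s.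
Proof. by move=> u0; rewrite normrM (ger0_norm u0) powRM. Qed.

Lemma small_powR_scale m s eta : 0 < s -> 0 < eta ->
  exists2 eps, 0 < eps & \sum_(j < m) eps `^ s <= eta.
Proof.
move=> s0 eta0; exists ((eta / m.+1%:R) `^ s^-1).
  by rewrite powR_gt0// divr_gt0.
have d0 : 0 <= eta / m.+1%:R by rewrite divr_ge0// ltW.
rewrite sumr_const card_ord (powR_rootK s0 d0) -[_ *+ m]mulr_natl.
rewrite mulrCA ler_piMr ?(ltW eta0)//.
by rewrite ler_pdivrMr// mul1r ler_nat.
Qed.

Lemma powR_root_le s x y : 0 < s -> 0 <= x -> 0 <= y ->
  (x `^ s^-1 <= y) = (x <= y `^ s).
Proof.
move=> s0 x0 y0; apply/idP/idP => h.
  rewrite -(powR_rootK s0 x0).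
  by rewrite ge0_ler_powR ?nnegrE ?powR_ge0// ltW.
rewrite -(powR_Kroot s0 y0).
by rewrite ge0_ler_powR ?nnegrE ?powR_ge0 ?invr_ge0// ltW.
Qed.

Lemma powmix_le t s x y x' y' : 0 <= t <= 1 -> 1 <= s ->
  0 <= x -> 0 <= y -> x <= x' -> y <= y' ->
  powmix t s x y <= powmix t s x' y'.
Proof.
move=> /andP[t0 t1] s1 x0 y0 xx yy; have s0 : 0 < s := lt_le_trans ltr01 s1.
have t1' : 0 <= 1 - t by rewrite subr_ge0.
have x'0 := le_trans x0 xx; have y'0 := le_trans y0 yy.
apply: ge0_ler_powR; rewrite ?nnegrE ?invr_ge0 ?(ltW s0)//.
- by rewrite addr_ge0// mulr_ge0 ?powR_ge0.
- by rewrite addr_ge0// mulr_ge0 ?powR_ge0.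
by rewrite lerD// ler_wpM2l// ge0_ler_powR ?nnegrE ?(ltW s0).
Qed.

(** Convexity of [x `^ s] at the points [x / A] and [y / B] with weights
    proportional to [A] and [B]. *)
Lemma powR_addM s A B x y : 1 <= s -> 0 < A -> 0 < B -> 0 <= x -> 0 <= y ->
  (x + y) `^ s <=
  (A + B) `^ s * (A / (A + B) * (x / A) `^ s + B / (A + B) * (y / B) `^ s).
Proof.
move=> s1 A0 B0 x0 y0; have AB0 := addr_gt0 A0 B0.
have An : A != 0 by rewrite gt_eqF.
have Bn : B != 0 by rewrite gt_eqF.
have ABn : A + B != 0 by rewrite gt_eqF.
have -> : B / (A + B) = 1 - A / (A + B).
  by rewrite -(divff ABn) -mulrBl addrAC subrr add0r.
have l0 : 0 <= A / (A + B) by rewrite divr_ge0 ?(ltW A0) ?(ltW AB0).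
have l1 : A / (A + B) <= 1 by rewrite ler_pdivrMr// mul1r lerDl (ltW B0).
have xA : 0 <= x / A by rewrite divr_ge0 ?(ltW A0).
have yB : 0 <= y / B by rewrite divr_ge0 ?(ltW B0).
have -> : x + y = (A + B) * (A / (A + B) * (x / A) + (1 - A / (A + B)) * (y / B)).
  by field; rewrite An Bn ABn.
rewrite [leLHS]powRM ?(ltW AB0)//; last first.
  by rewrite addr_ge0// mulr_ge0// subr_ge0.
by rewrite ler_wpM2l ?powR_ge0// powR_convex// l0 l1.
Qed.

Lemma powmix_unit t s N u v : 0 <= t <= 1 -> 1 <= s -> 0 <= u -> 0 <= v ->
  0 < N -> powmix t s u v <= N ->
  t * (u / N) `^ s + (1 - t) * (v / N) `^ s <= 1.
Proof.
move=> /andP[t0 t1] s1 u0 v0 N0; have s0 : 0 < s := lt_le_trans ltr01 s1.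
rewrite /powmix powR_root_le ?(ltW N0)//; last first.
  by rewrite addr_ge0// mulr_ge0 ?powR_ge0 ?subr_ge0.
rewrite !powRM ?invr_ge0 ?(ltW N0)// 2!mulrA -mulrDl => /ler_wpM2r le.
apply: le_trans (le _ (powR_ge0 _ _)) _.
by rewrite -powRM ?invr_ge0 ?(ltW N0)// divff ?gt_eqF// powR1.
Qed.

Lemma powmixD_le t s a b c d A B : 0 <= t <= 1 -> 1 <= s ->
  0 <= a -> 0 <= b -> 0 <= c -> 0 <= d -> 0 < A -> 0 < B ->
  powmix t s a c <= A -> powmix t s b d <= B ->
  powmix t s (a + b) (c + d) <= A + B.
Proof.
move=> t01 s1 a0 b0 c0 d0 Ap Bp; have s0 : 0 < s := lt_le_trans ltr01 s1.
have /andP[t0 t1] := t01; have t1' : 0 <= 1 - t by rewrite subr_ge0.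
move=> /powmix_unit hA /powmix_unit hB; have ABp := addr_gt0 Ap Bp.
have {}hA := hA t01 s1 a0 c0 Ap; have {}hB := hB t01 s1 b0 d0 Bp.
rewrite /powmix powR_root_le ?(ltW ABp)//; last first.
  by rewrite addr_ge0// mulr_ge0 ?powR_ge0.
have := lerD (ler_wpM2l t0 (powR_addM s1 Ap Bp a0 b0))
             (ler_wpM2l t1' (powR_addM s1 Ap Bp c0 d0)).
move=> /le_trans; apply.
have -> (k l l' p q u v : R) :
    t * (k * (l * p + l' * q)) + (1 - t) * (k * (l * u + l' * v)) =
    k * (l * (t * p + (1 - t) * u) + l' * (t * q + (1 - t) * v)) by ring.
rewrite ler_piMr ?powR_ge0//.
have l0 : 0 <= A / (A + B) by rewrite divr_ge0 ?(ltW Ap) ?(ltW ABp).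
have l1 : 0 <= B / (A + B) by rewrite divr_ge0 ?(ltW Bp) ?(ltW ABp).
apply: le_trans (lerD (ler_wpM2l l0 hA) (ler_wpM2l l1 hB)) _.
by rewrite !mulr1 -mulrDl divff// gt_eqF.
Qed.

(** Minkowski's inequality for the weighted [l_s] norm on the plane; the
    [e / 2] keep the normalizing constants of [powmixD_le] positive. *)
Lemma powmixD t s a b c d : 0 <= t <= 1 -> 1 <= s ->
  0 <= a -> 0 <= b -> 0 <= c -> 0 <= d ->
  powmix t s (a + b) (c + d) <= powmix t s a c + powmix t s b d.
Proof.
move=> t01 s1 a0 b0 c0 d0; apply/ler_addgt0Pr => e e0.
have e20 : 0 < e / 2 by rewrite divr_gt0.
rewrite [X in _ + _ + X](splitr e) addrACA.
apply: powmixD_le => //; first exact: ltr_wpDl (powmix_ge0 t s a c) e20.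
- exact: ltr_wpDl (powmix_ge0 t s b d) e20.
- by rewrite lerDl (ltW e20).
- by rewrite lerDl (ltW e20).
Qed.

End powR_inequalities.

(** * Finite sequence norms and Hoelder's inequality *)

Section mixed_conj_values.
Context {R : realType}.
Implicit Types (s p : \bar R).

Lemma mixed_conj_infty p : (0 < p)%E -> mixed_conj +oo%E p = p.
Proof. by move=> p0; rewrite /mixed_conj invey sube0 inveK. Qed.

Lemma mixed_conj_refl s : (0 < s)%E -> mixed_conj s s = +oo%E.
Proof.
move=> s0; rewrite /mixed_conj subee ?inve0//.
by case: s s0 => [s||]//; rewrite lte_fin => s0; rewrite inver gt_eqF.
Qed.

Lemma mixed_conj_fin (s p : R) : 0 < p -> p < s ->
  mixed_conj s%:E p%:E = ((p^-1 - s^-1)^-1)%:E.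
Proof.
move=> p0 ps; rewrite /mixed_conj !inver !gt_eqF ?(lt_trans p0 ps)//.
by rewrite -EFinB inver gt_eqF// subr_gt0 ltf_pV2 ?posrE// (lt_trans p0).
Qed.

End mixed_conj_values.

Section lpnorm_theory.
Context {R : realType}.
Implicit Types (p s : \bar R) (m : nat).

Lemma lpnorm_ge0 p m (a : 'I_m -> R) : 0 <= lpnorm p a.
Proof.
case: p => [p||]//=; first exact: powR_ge0.
by elim/big_ind: _ => // x y x0 y0; rewrite le_max x0.
Qed.

Lemma lpnorm_inftyP m (a : 'I_m -> R) (A : R) : 0 <= A ->
  (lpnorm +oo%E a <= A) <-> (forall j, `|a j| <= A).
Proof.
move=> A0; split=> [aA j|aA].
  by apply: le_trans aA; exact: (le_bigmax _ (fun j => `|a j|)).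
by apply: bigmax_le => // j _; exact: aA.
Qed.

Lemma lpnorm_infty_ub m (a : 'I_m -> R) j : `|a j| <= lpnorm +oo%E a.
Proof. exact: (lpnorm_inftyP a (lpnorm_ge0 _ a)).1. Qed.

Lemma lpnorm_finE (p : R) m (a : 'I_m -> R) : 0 < p ->
  lpnorm p%:E a `^ p = \sum_j `|a j| `^ p.
Proof.
move=> p0; rewrite /lpnorm -powRrM mulVf ?gt_eqF// powRr1//.
by apply: sumr_ge0 => j _; exact: powR_ge0.
Qed.

Lemma lpnorm_powE (p q : R) m (a : 'I_m -> R) :
  lpnorm q%:E a `^ p = (\sum_j `|a j| `^ q) `^ (p / q).
Proof. by rewrite /lpnorm -powRrM mulrC. Qed.

Lemma lpnorm_fin_le (p : R) m (a : 'I_m -> R) (A : R) : 0 < p -> 0 <= A ->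
  (lpnorm p%:E a <= A) = (\sum_j `|a j| `^ p <= A `^ p).
Proof.
move=> p0 A0; rewrite /lpnorm powR_root_le//.
by apply: sumr_ge0 => j _; exact: powR_ge0.
Qed.

Lemma le_lpnorm p m (a b : 'I_m -> R) : (0 < p)%E ->
  (forall j, `|a j| <= `|b j|) -> lpnorm p a <= lpnorm p b.
Proof.
case: p => [p||//] p0 ab.
  rewrite lte_fin in p0; rewrite lpnorm_fin_le ?lpnorm_ge0// lpnorm_finE//.
  by apply: ler_sum => j _; rewrite ge0_ler_powR ?nnegrE ?(ltW p0)// ab.
apply/lpnorm_inftyP => [|j]; first exact: lpnorm_ge0.
exact: le_trans (ab j) (lpnorm_infty_ub b j).
Qed.

Lemma lpnormZ_le p m (c : R) (a : 'I_m -> R) : (0 < p)%E -> 0 <= c ->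
  lpnorm p (fun j => c * a j) <= c * lpnorm p a.
Proof.
case: p => [p||//] p0 c0.
  rewrite lte_fin in p0.
  rewrite lpnorm_fin_le ?mulr_ge0 ?lpnorm_ge0//.
  rewrite powRM ?lpnorm_ge0// lpnorm_finE// mulr_sumr.
  by apply: ler_sum => j _; rewrite normrM powRM// ger0_norm.
apply/lpnorm_inftyP => [|j]; first by rewrite mulr_ge0 ?lpnorm_ge0.
by rewrite normrM (ger0_norm c0) ler_wpM2l ?lpnorm_infty_ub.
Qed.

Lemma lpnormM_infty p m (a b : 'I_m -> R) : (0 < p)%E ->
  lpnorm p (fun j => a j * b j) <= lpnorm +oo%E a * lpnorm p b.
Proof.
move=> p0; apply: le_trans (lpnormZ_le b p0 (lpnorm_ge0 _ a)).
apply: le_lpnorm => // j; rewrite !normrM ler_wpM2r//.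
by rewrite (ger0_norm (lpnorm_ge0 _ a)) lpnorm_infty_ub.
Qed.

(** Hoelder's inequality [1/p = 1/s'(p) + 1/s]. The exponents [p = s] and
    [s = +oo] are those in which one of the two factors is a maximum. *)
Lemma lpnormM p s m (a b : 'I_m -> R) : (0 < p)%E -> (p <= s)%E ->
  lpnorm p (fun j => a j * b j) <= lpnorm (mixed_conj s p) a * lpnorm s b.
Proof.
move=> p0; rewrite le_eqVlt => /predU1P[<-|ps].
  by rewrite mixed_conj_refl// lpnormM_infty.
case: s ps => [s ps|_|]; [| |by rewrite ltNge leNye]; last first.
  rewrite mixed_conj_infty// mulrC.
  apply: le_trans (lpnormM_infty b a p0).
  by apply: le_lpnorm => // j; rewrite mulrC.
case: p p0 ps => [p||]// p0 plts; rewrite !lte_fin in p0 plts.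
have s0 := lt_trans p0 plts.
rewrite mixed_conj_fin//.
have [q qE] : {q : R | q = (p^-1 - s^-1)^-1} by exists (p^-1 - s^-1)^-1.
rewrite -qE.
have q0 : 0 < q by rewrite qE invr_gt0 subr_gt0 ltf_pV2 ?posrE.
have ps : 1 - p / q = p / s by rewrite qE invrK mulrBr divff ?gt_eqF// subKr.
have pq01 : 0 < p / q < 1.
  by rewrite divr_gt0//= -subr_gt0 ps divr_gt0.
rewrite lpnorm_fin_le ?mulr_ge0 ?lpnorm_ge0//.
have h := hoelder_sum pq01 (a := fun j => `|a j| `^ q)
  (b := fun j => `|b j| `^ s) (fun j => powR_ge0 _ _) (fun j => powR_ge0 _ _).
have hE : (lpnorm q%:E a * lpnorm s%:E b) `^ p =
    (\sum_j `|a j| `^ q) `^ (p / q) * (\sum_j `|b j| `^ s) `^ (p / s).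
  apply: etrans (powRM p (lpnorm_ge0 _ _) (lpnorm_ge0 _ _)) _.
  congr (_ * _).
    exact (lpnorm_powE p q a).
  exact (lpnorm_powE p s b).
rewrite hE; rewrite ps in h; apply: le_trans h.
have sps : s * (p / s) = p by rewrite mulrCA divff ?mulr1// gt_eqF.
have qpq : q * (p / q) = p by rewrite mulrCA divff ?mulr1// gt_eqF.
apply: ler_sum => j _; rewrite -(powRrM `|a j|) -(powRrM `|b j|) sps qpq.
by rewrite normrM powRM.
Qed.

Lemma lpnorm_cst1 m : lpnorm +oo%E (fun _ : 'I_m => 1 : R) <= 1.
Proof. by apply/lpnorm_inftyP => // j; rewrite normr1. Qed.

End lpnorm_theory.

(** * Almost maximizing a sum of powers over a convex set *)

Section selection.
Context {R : realType}.

(** If [x] lies on a segment from [v] to a vector that is at most [c * v], at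
    the small parameter [t], then [v] and [x] agree up to factors tending to 1
    with [t], hence so do the coefficients of the tangents at [v] and at [x]. *)
Lemma shifted_weight_bounds (th t c x v : R) :
  0 < th < 1 -> 0 < t < 1 -> 0 <= c ->
  0 < v -> (1 - t) * v <= x -> x <= (1 + t * c) * v ->
  v `^ (th - 1) <= (1 + t * c) * x `^ (th - 1) /\
  x `^ (th - 1) * v <= (1 - t)^-1 * v `^ th.
Proof.
move=> /andP[th0 th1] /andP[t0 t1] c0 v0 xl xu.
have th10 : th - 1 <= 0 by rewrite subr_le0 ltW.
have thN : -1 <= th - 1 by rewrite lerBrDl subrr ltW.
have t1' : 0 < 1 - t by rewrite subr_gt0.
have x0 : 0 < x by apply: lt_le_trans xl; rewrite mulr_gt0.
have tc0 : 0 <= t * c by rewrite mulr_ge0// ltW.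
have K1 : 1 <= 1 + t * c by rewrite lerDl.
have K0 : 0 < 1 + t * c := lt_le_trans ltr01 K1.
split.
  have h := powR_antimono th10 x0 xu.
  rewrite powRM ?(ltW K0) ?(ltW v0)// in h.
  have hK : (1 + t * c)^-1 <= (1 + t * c) `^ (th - 1).
    by rewrite -powR_inv1 ?(ltW K0)// ler_powR.
  rewrite mulrC -ler_pdivrMr// mulrC; apply: le_trans h.
  by rewrite ler_wpM2r ?powR_ge0.
have h : x `^ (th - 1) <= ((1 - t) * v) `^ (th - 1).
  by apply: powR_antimono => //; rewrite mulr_gt0.
apply: le_trans (ler_wpM2r (ltW v0) h) _.
rewrite powRM ?(ltW t1') ?(ltW v0)// -mulrA [_ * v]mulrC.
rewrite mulr_powRB1 ?(ltW v0)// ler_wpM2r ?powR_ge0//.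
rewrite -powR_inv1 ?(ltW t1')// ger_powR//.
by rewrite t1' gerBl ltW.
Qed.

(** First-order condition at a maximizer [v] of [\sum_j v j `^ th], in
    approximate form: moving from [v] towards [w] cannot increase the sum, which
    forces [\sum_j v j `^ (th - 1) * w j <= \sum_j v j `^ th]. As [v] only almost
    maximizes, with defect below [t * th * eta / 4], the tangent inequality is
    applied at [x = v + t * (w - v)] for a fixed small [t], and
    [shifted_weight_bounds] brings the coefficients back from [x] to [v]. *)
Lemma near_maximizer_weights m (th c A eta : R) (E : set ('I_m -> R)) :
  0 < th < 1 -> 0 <= c -> 0 < eta -> E !=set0 ->
  (forall v j, E v -> 0 < v j) ->
  (forall v w j, E v -> E w -> w j <= c * v j) ->
  (forall t v w, 0 <= t <= 1 -> E v -> E w ->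
    E (fun j => t * w j + (1 - t) * v j)) ->
  (forall v, E v -> \sum_j v j `^ th <= A) ->
  exists2 v, E v & forall w, E w ->
    \sum_j v j `^ (th - 1) * w j <= A + eta.
Proof.
move=> th01 c0 eta0 [v0 Ev0] Epos Ec Econv EA.
have /andP[th0 th1] := th01.
have A0 : 0 <= A.
  by apply: le_trans (EA _ Ev0); apply: sumr_ge0 => j _; exact: powR_ge0.
(* the estimates below need [t <= 1/4], [t * c <= 1/4] and
   [4 * A * t * (1 + c) <= eta] *)
pose t := eta / (4 * (1 + c) * (A + 1 + eta)).
have den0 : 0 < 4 * (1 + c) * (A + 1 + eta).
  have c1 : 0 < 1 + c by rewrite ltr_wpDr.
  have A1 : 0 < A + 1 + eta by rewrite -addrA ltr_wpDl// addr_gt0.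
  by rewrite !mulr_gt0.
have tE : t * (4 * (1 + c) * (A + 1 + eta)) = eta by rewrite /t divfK ?gt_eqF.
have t0 : 0 < t by rewrite /t divr_gt0.
move: (t) t0 tE => {t den0} {}t t0 tE.
have t4 : t * (1 + c) <= 4^-1.
  have : t * (1 + c) * (4 * eta) <= 4^-1 * (4 * eta).
    rewrite [leRHS]mulKf// -[leRHS]tE -subr_ge0.
    have -> : t * (4 * (1 + c) * (A + 1 + eta)) - t * (1 + c) * (4 * eta) =
      t * (4 * (1 + c) * (A + 1)) by ring.
    by rewrite !mulr_ge0// ?addr_ge0// ltW.
  by rewrite ler_pM2r// mulr_gt0.
have tA : A * (t * (1 + c)) * 4 <= eta.
  rewrite -tE -subr_ge0.
  have -> : t * (4 * (1 + c) * (A + 1 + eta)) - A * (t * (1 + c)) * 4 =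
    t * (4 * (1 + c) * (1 + eta)) by ring.
  by rewrite !mulr_ge0// ?addr_ge0// ltW.
have t1 : t < 1.
  have : t <= t * (1 + c) by rewrite ler_peMr ?(ltW t0)// lerDl.
  by lra.
have t1' : 0 < 1 - t by rewrite subr_gt0.
pose phi (v : 'I_m -> R) := \sum_j v j `^ th.
have supE : has_sup (phi @` E).
  by split; [exists (phi v0), v0|exists A => _ [v Ev <-]; exact: EA].
have d0 : 0 < t * th * (eta / 4) by rewrite !mulr_gt0// invr_gt0.
have [_ [v Ev <-] vmax] := sup_adherent d0 supE.
exists v => // w Ew.
pose x j := t * w j + (1 - t) * v j.
have t01 : 0 <= t <= 1 by rewrite !ltW.
have Ex : E x by exact: Econv.
have xv : phi x <= phi v + t * th * (eta / 4).
  rewrite -lerBlDr; apply/ltW; apply: le_lt_trans vmax; rewrite lerD2r.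
  by apply: sup_upper_bound => //; exists x.
have bnd j := @shifted_weight_bounds th t c (x j) (v j) th01
  (_ : 0 < t < 1) c0 (Epos _ j Ev).
have {}bnd j : v j `^ (th - 1) <= (1 + t * c) * x j `^ (th - 1) /\
    x j `^ (th - 1) * v j <= (1 - t)^-1 * v j `^ th.
  apply: bnd; first by rewrite t0 t1.
    by rewrite lerDr mulr_ge0// ltW// Epos.
  rewrite -subr_ge0.
  have -> : (1 + t * c) * v j - x j = t * (c * v j - w j + v j).
    by rewrite /x; ring.
  rewrite mulr_ge0 ?(ltW t0)// addr_ge0 ?(ltW (Epos _ j Ev))//.
  by rewrite subr_ge0 Ec.
(* the tangent at [x] bounds [phi v], and [phi x <= phi v + t * th * eta / 4] *)
have first_order : \sum_j x j `^ (th - 1) * (w j - v j) <= eta / 4.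
  have : \sum_j t * th * (x j `^ (th - 1) * (w j - v j)) <= phi x - phi v.
    rewrite /phi -sumrB; apply: ler_sum => j _.
    have := powR_tangent th01 (ltW (Epos _ j Ev)) (Epos _ j Ex).
    have -> : v j - x j = - (t * (w j - v j)) by rewrite /x; ring.
    have -> : th * (x j `^ (th - 1) * - (t * (w j - v j))) =
      - (t * th * (x j `^ (th - 1) * (w j - v j))) by ring.
    by move=> h; rewrite lerBrDr -lerBrDl.
  rewrite -mulr_sumr => h.
  have {}h : t * th * \sum_j x j `^ (th - 1) * (w j - v j) <= t * th * (eta / 4).
    by rewrite (le_trans h)// lerBlDl.
  by rewrite ler_pM2l// mulr_gt0 in h.
have xw : \sum_j x j `^ (th - 1) * w j <= (1 - t)^-1 * A + eta / 4.
  have -> : \sum_j x j `^ (th - 1) * w j =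
      \sum_j x j `^ (th - 1) * v j + \sum_j x j `^ (th - 1) * (w j - v j).
    by rewrite -big_split; apply: eq_bigr => j _ /=; ring.
  apply: lerD => //.
  apply: le_trans (ler_wpM2l _ (EA _ Ev)); last by rewrite invr_ge0 ltW.
  by rewrite mulr_sumr; apply: ler_sum => j _; case: (bnd j).
apply: (@le_trans _ _ ((1 + t * c) * ((1 - t)^-1 * A + eta / 4))).
  apply: le_trans (ler_wpM2l _ xw); last by rewrite addr_ge0// mulr_ge0// ltW.
  rewrite mulr_sumr; apply: ler_sum => j _; rewrite mulrA.
  by rewrite ler_wpM2r ?(ltW (Epos _ j Ew))//; case: (bnd j).
have tc0 : 0 <= t * c by rewrite mulr_ge0// ltW.
have inv1 : (1 - t)^-1 <= 1 + 2 * t.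
  rewrite -[leLHS]mul1r ler_pdivrMr// -subr_ge0.
  have -> : (1 + 2 * t) * (1 - t) - 1 = t * (1 - 2 * t) by ring.
  by rewrite mulr_ge0 ?(ltW t0)//; rewrite mulrDr mulr1 in t4; lra.
have h1 : (1 + t * c) * ((1 - t)^-1 * A + eta / 4) <=
    (1 + t * c) * ((1 + 2 * t) * A + eta / 4).
  by rewrite ler_wpM2l ?addr_ge0// lerD2r ler_wpM2r.
apply: le_trans h1 _.
have tt : t * (t * c) <= 4^-1 * (t * c).
  by rewrite ler_wpM2r//; rewrite mulrDr mulr1 in t4; lra.
rewrite mulrDr mulr1 in t4 tA.
have hA : A * (t * (t * c)) <= A * (4^-1 * (t * c)) by rewrite ler_wpM2l.
have he : t * c * eta <= 4^-1 * eta by rewrite ler_wpM2r ?(ltW eta0)//; lra.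
have At : 0 <= A * t by rewrite mulr_ge0// ltW.
have Atc : 0 <= A * (t * c) by rewrite mulr_ge0.
move: hA he At Atc tA; rewrite mulrDr.
have -> : (1 + t * c) * ((1 + 2 * t) * A + eta / 4) =
  A + 2 * (A * t) + A * (t * c) + 2 * (A * (t * (t * c))) + eta / 4 +
  (t * c * eta) / 4.
  by field.
have -> : A * (4^-1 * (t * c)) = 4^-1 * (A * (t * c)) by ring.
by lra.
Qed.

End selection.

(** * Weakly dominated pseudometrics and the mixed norm *)

Section weak_norm_theory.
Context {R : realType} {Y : metricType R} (y0 : Y).
Implicit Types (s p : \bar R) (m : nat) (f : Y -> R) (rho : Y -> Y -> R).

Lemma lpnorm_ord1 s (a : 'I_1 -> R) : (0 < s)%E -> lpnorm s a = `|a ord0|.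
Proof.
case: s => [s||//] s0 /=.
  by rewrite lte_fin in s0; rewrite big_ord1 -powRrM mulfV ?gt_eqF// powRr1.
by rewrite big_ord_recl big_ord0 max_l.
Qed.

Lemma lip_dual_ballP f : lip_dual_ball y0 f <->
  f y0 = 0 /\ forall y z, `|f y - f z| <= mdist y z.
Proof.
split=> [[[Lf f0] f1]|[f0 f1]].
  have h := (@Lip_le1P R Y R^o f).1 (conj Lf f1).
  by split=> // y z; have := h y z; rewrite {1}/mdist/= distrC.
have h y z : mdist (f y : R^o) (f z : R^o) <= mdist y z.
  by rewrite {1}/mdist/= distrC f1.
have [Lf fle] := (@Lip_le1P R Y R^o f).2 h.
by split; [split|].
Qed.

Lemma weak_norm_ub s m (sigma : 'I_m -> R) (y' y'' : 'I_m -> Y) f :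
  lip_dual_ball y0 f ->
  ((lpnorm s (fun j => sigma j * (f (y' j) - f (y'' j))))%:E <=
   weak_norm y0 s sigma y' y'')%E.
Proof. by move=> fB; apply: ereal_sup_ubound; exists f. Qed.

Lemma weak_norm_leP s m (sigma : 'I_m -> R) (y' y'' : 'I_m -> Y) (W : R) :
  (weak_norm y0 s sigma y' y'' <= W%:E)%E <->
  forall f, lip_dual_ball y0 f ->
    lpnorm s (fun j => sigma j * (f (y' j) - f (y'' j))) <= W.
Proof.
split=> [h f fB|h].
  by rewrite -lee_fin; apply: le_trans h; exact: weak_norm_ub.
by apply: ge_ereal_sup => _ [f fB <-]; rewrite lee_fin h.
Qed.

Lemma zero_lip_dual_ball : lip_dual_ball y0 (fun=> 0).
Proof. by apply/lip_dual_ballP; split=> // y z; rewrite subrr normr0 mdist_ge0. Qed.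

Lemma weak_norm_ge0 s m (sigma : 'I_m -> R) (y' y'' : 'I_m -> Y) :
  (0 <= weak_norm y0 s sigma y' y'')%E.
Proof.
apply: le_trans (weak_norm_ub s sigma y' y'' zero_lip_dual_ball).
by rewrite lee_fin lpnorm_ge0.
Qed.

Lemma weak_norm_le_strong s m (sigma : 'I_m -> R) (y' y'' : 'I_m -> Y) :
  (0 < s)%E ->
  (weak_norm y0 s sigma y' y'' <= strong_norm s sigma y' y'')%E.
Proof.
move=> s0; apply/weak_norm_leP => f /lip_dual_ballP[_ f1].
apply: le_lpnorm => // j; rewrite !normrM ler_wpM2l//.
by rewrite [leRHS]ger0_norm ?mdist_ge0.
Qed.

Lemma weak_norm_fin s m (sigma : 'I_m -> R) (y' y'' : 'I_m -> Y) : (0 < s)%E ->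
  exists2 W : R, 0 <= W & weak_norm y0 s sigma y' y'' = W%:E.
Proof.
move=> s0; have := weak_norm_le_strong sigma y' y'' s0.
have := weak_norm_ge0 s sigma y' y''; rewrite /strong_norm.
by case: (weak_norm _ _ _ _ _) => [w||]//; rewrite lee_fin => w0 _; exists w.
Qed.

Definition pseudometric rho :=
  [/\ forall y z, 0 <= rho y z, forall y, rho y y = 0,
      forall y z, rho y z = rho z y &
      forall x y z, rho x z <= rho x y + rho y z].

(** For [s < +oo] this is how [rho ^ s] behaves if it is an average of
    [|f y - f z| ^ s] over a probability measure on the unit ball of the
    Lipschitz dual; for [s = +oo] it means that [rho] is bounded by the distance
    of [Y]. *)
Definition weakly_dominated s rho :=
  forall m (sigma : 'I_m -> R) (y' y'' : 'I_m -> Y),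
    ((lpnorm s (fun j => sigma j * rho (y' j) (y'' j)))%:E <=
     weak_norm y0 s sigma y' y'')%E.

Lemma weakly_dominated_le s rho : (0 < s)%E -> weakly_dominated s rho ->
  forall y z, rho y z <= mdist y z.
Proof.
move=> s0 h y z.
have := h 1 (fun=> 1) (fun=> y) (fun=> z).
move=> /le_trans /(_ (weak_norm_le_strong _ _ _ s0)).
rewrite lee_fin !lpnorm_ord1// !mul1r [leRHS]ger0_norm ?mdist_ge0//.
exact: le_trans (ler_norm _).
Qed.

(** The distance to [y''_j], recentred at [y0], attains the Lipschitz bound on
    the pair [(y'_j, y''_j)]. *)
Lemma mdist_weakly_dominated : weakly_dominated +oo%E (@mdist R Y).
Proof.
move=> m sigma y' y''.
have [W W0 WE] := weak_norm_fin sigma y' y'' (ltry 0).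
rewrite WE lee_fin; apply/lpnorm_inftyP => // j.
pose f y := mdist y (y'' j) - mdist y0 (y'' j).
have fB : lip_dual_ball y0 f.
  apply/lip_dual_ballP; split=> [|y z]; first by rewrite /f subrr.
  rewrite /f opprB addrA subrK ler_norml; apply/andP; split.
    by rewrite lerNl opprB lerBlDr [mdist y z]metric_sym metric_triangle.
  by rewrite lerBlDr metric_triangle.
have := weak_norm_ub +oo%E sigma y' y'' fB; rewrite WE lee_fin.
apply: le_trans.
have := lpnorm_infty_ub (fun j => sigma j * (f (y' j) - f (y'' j))) j.
by apply: le_trans; rewrite /f mdistxx opprB addrA subrK subr0.
Qed.

Lemma pseudometric_mdist : pseudometric (@mdist R Y).
Proof.
split; [exact: mdist_ge0|exact: mdistxx|exact: metric_sym|].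
exact: metric_triangle.
Qed.

Lemma pseudometric_lip f : pseudometric (fun y z => `|f y - f z|).
Proof.
split=> [y z|y|y z|x y z]//; first by rewrite subrr normr0.
  exact: distrC.
exact: ler_distD.
Qed.

Lemma weakly_dominated_lip s f : (0 < s)%E -> lip_dual_ball y0 f ->
  weakly_dominated s (fun y z => `|f y - f z|).
Proof.
move=> s0 fB m sigma y' y''.
apply: le_trans (weak_norm_ub s sigma y' y'' fB).
by rewrite lee_fin; apply: le_lpnorm => // j; rewrite !normrM normr_id.
Qed.

Lemma pseudometric_powmix (t s : R) rho1 rho2 : 0 <= t <= 1 -> 1 <= s ->
  pseudometric rho1 -> pseudometric rho2 ->
  pseudometric (fun y z => powmix t s (rho1 y z) (rho2 y z)).
Proof.
move=> t01 s1 [ge1 xx1 sym1 tri1] [ge2 xx2 sym2 tri2].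
have s0 : 0 < s := lt_le_trans ltr01 s1.
split=> [y z|y|y z|x y z].
- exact: powmix_ge0.
- by rewrite xx1 xx2 /powmix powR0 ?gt_eqF// !mulr0 addr0 powR0// gt_eqF ?invr_gt0.
- by rewrite sym1 sym2.
apply: le_trans (powmixD t01 s1 (ge1 _ _) (ge1 _ _) (ge2 _ _) (ge2 _ _)).
exact: powmix_le.
Qed.

Lemma weakly_dominated_powmix (t s : R) rho1 rho2 : 0 <= t <= 1 -> 1 <= s ->
  weakly_dominated s%:E rho1 -> weakly_dominated s%:E rho2 ->
  (forall y z, 0 <= rho1 y z) -> (forall y z, 0 <= rho2 y z) ->
  weakly_dominated s%:E (fun y z => powmix t s (rho1 y z) (rho2 y z)).
Proof.
move=> t01 s1 d1 d2 ge1 ge2 m sigma y' y''.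
have s0 : 0 < s := lt_le_trans ltr01 s1.
have [W W0 WE] := weak_norm_fin sigma y' y'' (s0 : 0 < s%:E)%E.
have h1 : \sum_j `|sigma j * rho1 (y' j) (y'' j)| `^ s <= W `^ s.
  by rewrite -lpnorm_fin_le// -lee_fin -WE; exact: d1.
have h2 : \sum_j `|sigma j * rho2 (y' j) (y'' j)| `^ s <= W `^ s.
  by rewrite -lpnorm_fin_le// -lee_fin -WE; exact: d2.
rewrite WE lee_fin lpnorm_fin_le//.
have /andP[t0 t1] := t01; have t1' : 0 <= 1 - t by rewrite subr_ge0.
have := lerD (ler_wpM2l t0 h1) (ler_wpM2l t1' h2).
rewrite -mulrDl subrKC mul1r; apply: le_trans.
rewrite !mulr_sumr -big_split/=; apply: ler_sum => j _.
rewrite (powR_normM _ _ (ge1 _ _)) (powR_normM _ _ (ge2 _ _)).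
rewrite (powR_normM _ _ (powmix_ge0 _ _ _ _)).
by rewrite powmixK// mulrDr !(mulrCA (`|sigma j| `^ s)).
Qed.

End weak_norm_theory.

Section mixed_norm_theory.
Context {R : realType} {Y : metricType R} (y0 : Y).
Implicit Types (s p : \bar R) (m : nat) (f : Y -> R) (rho : Y -> Y -> R).

Lemma mixed_norm_le s p m (sigma tau : 'I_m -> R) (y' y'' : 'I_m -> Y) :
  (forall j, tau j != 0) ->
  (mixed_norm y0 s p sigma y' y'' <=
   (lpnorm (mixed_conj s p) tau)%:E *
   weak_norm y0 s (fun j => sigma j / tau j)%R y' y'')%E.
Proof. by move=> tau0; apply: ereal_inf_lbound; exists tau. Qed.

(** The easy half of the duality: split [sigma_j * rho_j] as [tau_j] times
    [(sigma_j / tau_j) * rho_j] and apply Hoelder's inequality. *)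
Lemma lpnorm_le_mixed_norm s p rho m (sigma : 'I_m -> R) (y' y'' : 'I_m -> Y) :
  (0 < p)%E -> (p <= s)%E -> weakly_dominated y0 s rho ->
  ((lpnorm p (fun j => sigma j * rho (y' j) (y'' j)))%:E <=
   mixed_norm y0 s p sigma y' y'')%E.
Proof.
move=> p0 ps hrho; have s0 := lt_le_trans p0 ps.
apply: le_ereal_inf_tmp => _ [tau tau0 <-].
have [W W0 WE] := weak_norm_fin y0 (fun j => sigma j / tau j) y' y'' s0.
have := hrho m (fun j => sigma j / tau j) y' y''; rewrite WE -EFinM !lee_fin.
move=> /(ler_wpM2l (lpnorm_ge0 (mixed_conj s p) tau)); apply: le_trans.
apply: le_trans (lpnormM _ _ p0 ps); apply: le_lpnorm => // j.
by rewrite mulrA mulrCA divff// mulr1.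
Qed.

Lemma mixed_norm_refl p m (sigma : 'I_m -> R) (y' y'' : 'I_m -> Y) :
  (0 < p)%E ->
  mixed_norm y0 p p sigma y' y'' = weak_norm y0 p sigma y' y''.
Proof.
move=> p0; apply/eqP; rewrite eq_le; apply/andP; split.
  have [W W0 WE] := weak_norm_fin y0 sigma y' y'' p0.
  have := @mixed_norm_le p p m sigma (fun=> 1) y' y'' (fun=> oner_neq0 _).
  rewrite [X in weak_norm _ _ X](_ : _ = sigma); last first.
    by apply/funext => j; rewrite divr1.
  rewrite mixed_conj_refl// WE -EFinM => /le_trans; apply.
  by rewrite lee_fin ler_piMl// lpnorm_cst1.
apply: ge_ereal_sup => _ [f fB <-].
have := lpnorm_le_mixed_norm sigma y' y'' p0 (lexx p) (weakly_dominated_lip p0 fB).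
by apply: le_trans; rewrite lee_fin le_lpnorm// => j; rewrite !normrM normr_id.
Qed.

Lemma mixed_norm_ge0 s p m (sigma : 'I_m -> R) (y' y'' : 'I_m -> Y) :
  (0 <= mixed_norm y0 s p sigma y' y'')%E.
Proof.
apply: le_ereal_inf_tmp => _ [tau tau0 <-].
by rewrite mule_ge0 ?lee_fin ?lpnorm_ge0 ?weak_norm_ge0.
Qed.

Lemma mixed_norm_fin s p m (sigma : 'I_m -> R) (y' y'' : 'I_m -> Y) :
  (0 < s)%E ->
  exists2 M : R, 0 <= M & mixed_norm y0 s p sigma y' y'' = M%:E.
Proof.
move=> s0.
have := @mixed_norm_le s p m sigma (fun=> 1) y' y'' (fun=> oner_neq0 _).
have [W W0 ->] := weak_norm_fin y0 (fun j => sigma j / 1) y' y'' s0.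
have := mixed_norm_ge0 s p sigma y' y''; rewrite -EFinM.
by case: (mixed_norm _ _ _ _ _ _) => [w||]//; rewrite lee_fin => w0 _; exists w.
Qed.

End mixed_norm_theory.

(** * The mixed norm as a supremum over weakly dominated pseudometrics *)

Section domination.
Context {R : realType} {Y : metricType R} (y0 : Y).
Implicit Types (m : nat) (f : Y -> R) (rho : Y -> Y -> R).

Lemma le_of_powR_approx (p A : R) (x : \bar R) : 0 < p -> 0 <= A ->
  (forall eta : R, 0 < eta -> (x <= ((A `^ p + eta) `^ p^-1)%:E)%E) ->
  (x <= A%:E)%E.
Proof.
move=> p0 A0 h; apply/lee_addgt0Pr => e e0.
have Ae : 0 <= A + e by rewrite addr_ge0// ltW.
have : 0 < (A + e) `^ p - A `^ p.
  rewrite subr_gt0; apply: gt0_ltr_powR => //.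
  by rewrite ltrDl.
move=> /h; rewrite subrKC.
have -> : ((A + e) `^ p) `^ p^-1 = A + e.
  by rewrite -powRrM mulfV ?gt_eqF// powRr1.
by rewrite EFinD.
Qed.

(** The factor [tau j = v j `^ ((1 - p / s) / s)] turns the two bounds on sums into
    [||tau|l_q|| <= B ^ (1/q)], [q = s'(p)], and
    [||sigma / tau|l_s^w|| <= B ^ (1/s)], and [1/q + 1/s = 1/p]. *)
Lemma mixed_norm_le_weights (s p B : R) m (sigma v : 'I_m -> R)
    (y' y'' : 'I_m -> Y) :
  0 < p -> p < s -> 0 < B -> (forall j, 0 < v j) ->
  \sum_j v j `^ (p / s) <= B ->
  (forall f, lip_dual_ball y0 f ->
    \sum_j v j `^ (p / s - 1) * `|sigma j * (f (y' j) - f (y'' j))| `^ s <= B) ->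
  (mixed_norm y0 s%:E p%:E sigma y' y'' <= (B `^ p^-1)%:E)%E.
Proof.
move=> p0 ps B0 v0 vB fB; have s0 := lt_trans p0 ps.
have pn : p != 0 by rewrite gt_eqF.
have sn : s != 0 by rewrite gt_eqF.
have qinv : 0 < p^-1 - s^-1 by rewrite subr_gt0 ltf_pV2 ?posrE.
pose k := (1 - p / s) / s.
pose tau j := v j `^ k.
have tau0 j : 0 < tau j by rewrite powR_gt0.
have taun j : tau j != 0 by rewrite gt_eqF.
apply: le_trans (mixed_norm_le y0 s%:E p%:E sigma y' y'' taun) _.
have [W W0 WE] := weak_norm_fin y0 (fun j => sigma j / tau j) y' y''
  (s0 : 0 < s%:E)%E.
rewrite WE mixed_conj_fin// -EFinM lee_fin.
have [q qE] : {q : R | q = (p^-1 - s^-1)^-1} by exists (p^-1 - s^-1)^-1.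
rewrite -qE; have q0 : 0 < q by rewrite qE invr_gt0.
have kq : k * q = p / s.
  by rewrite /k qE; field; rewrite pn sn mulN1r subr_eq0 gt_eqF.
have ks : k * s = 1 - p / s by rewrite /k divfK.
have pE : p^-1 = q^-1 + s^-1 by rewrite qE invrK subrK.
have hq : lpnorm q%:E tau <= B `^ q^-1.
  rewrite lpnorm_fin_le ?powR_ge0//.
  rewrite (powR_rootK q0 (ltW B0)); apply: le_trans vB.
  apply: ler_sum => j _; rewrite (ger0_norm (ltW (tau0 j))).
  by rewrite /tau -powRrM kq.
have hs : W <= B `^ s^-1.
  rewrite -lee_fin -WE; apply/weak_norm_leP => f /fB fB'.
  rewrite lpnorm_fin_le ?powR_ge0//.
  rewrite (powR_rootK s0 (ltW B0)); apply: le_trans fB'.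
  apply: ler_sum => j _.
  have -> : sigma j / tau j * (f (y' j) - f (y'' j)) =
      (tau j)^-1 * (sigma j * (f (y' j) - f (y'' j))) by rewrite mulrAC mulrC mulrA.
  rewrite normrM powRM// ler_wpM2r ?powR_ge0//.
  rewrite ger0_norm ?invr_ge0 ?(ltW (tau0 j))//.
  by rewrite /tau -powRN -powRrM mulNr ks opprB.
rewrite pE powRD ?(gt_eqF B0) ?implybT//.
exact: ler_pM (lpnorm_ge0 _ _) W0 hq hs.
Qed.

(** The vectors [|sigma_j rho_j| ^ s] form a convex set, as weakly dominated
    pseudometrics are stable under [l_s] means. Adding [eps] keeps the
    coordinates away from 0, where [x `^ (p / s)] is not differentiable; by
    subadditivity of that function the cost is [m * eps `^ (p / s)]. *)
Lemma mixed_norm_le_dominated_fin (s p A : R) m (sigma : 'I_m -> R)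
    (y' y'' : 'I_m -> Y) :
  1 <= s -> 0 < p -> p < s -> 0 <= A ->
  (forall rho, pseudometric rho -> weakly_dominated y0 s%:E rho ->
    lpnorm p%:E (fun j => sigma j * rho (y' j) (y'' j)) <= A) ->
  (mixed_norm y0 s%:E p%:E sigma y' y'' <= A%:E)%E.
Proof.
move=> s1 p0 ps A0 hA; have s0 := lt_trans p0 ps.
have s0e : (0 < s%:E)%E by [].
have sn : s != 0 by rewrite gt_eqF.
have th0 : 0 < p / s by rewrite divr_gt0.
have th01 : 0 < p / s < 1 by rewrite th0 ltr_pdivrMr// mul1r.
apply: (le_of_powR_approx p0 A0) => eta eta0.
have B0 : 0 < A `^ p + eta by rewrite ltr_wpDl ?powR_ge0.
have eta2 : 0 < eta / 2 by rewrite divr_gt0.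
have [eps eps0 meps] := small_powR_scale m th0 eta2.
pose vec rho j : R := `|sigma j * rho (y' j) (y'' j)| `^ s + eps.
pose E := [set v | exists rho, [/\ pseudometric rho,
  weakly_dominated y0 s%:E rho & v = vec rho]].
pose D : R := \sum_j `|sigma j * mdist (y' j) (y'' j)| `^ s.
have D0 : 0 <= D by apply: sumr_ge0 => j _; exact: powR_ge0.
have vec_eps rho j : eps <= vec rho j by rewrite /vec lerDr powR_ge0.
have vec_le rho j : pseudometric rho -> weakly_dominated y0 s%:E rho ->
    vec rho j <= D + eps.
  move=> [rho0 _ _ _] drho; rewrite /vec lerD2r.
  rewrite /D (bigD1 j)//= ler_wpDr//.
    by apply: sumr_ge0 => i _; exact: powR_ge0.
  apply: ge0_ler_powR; rewrite ?nnegrE ?(ltW s0)//.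
  rewrite !normrM ler_wpM2l// !ger0_norm// ?mdist_ge0//.
  exact: weakly_dominated_le drho _ _.
have E0 : E !=set0.
  have z0 := zero_lip_dual_ball y0.
  pose rho0 (y z : Y) : R := `|0 - 0 : R|.
  exists (vec rho0), rho0; split=> //.
    exact: (pseudometric_lip (fun=> 0)).
  exact: (weakly_dominated_lip s0e z0).
have Epos v j : E v -> 0 < v j.
  by move=> [rho [_ _ ->]]; exact: lt_le_trans eps0 (vec_eps _ _).
have Ec v w j : E v -> E w -> w j <= (D + eps) / eps * v j.
  move=> [rho [_ _ ->]] [rho' [prho' drho' ->]].
  apply: le_trans (vec_le rho' j prho' drho') _.
  rewrite mulrAC -mulrA ler_peMr//; first by rewrite addr_ge0// ltW.
  by rewrite ler_pdivlMr// mul1r.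
have Econv t v w : 0 <= t <= 1 -> E v -> E w ->
    E (fun j => t * w j + (1 - t) * v j).
  move=> t01 [rho1 [p1 d1 ->]] [rho2 [p2 d2 ->]].
  have [g1 _ _ _] := p1; have [g2 _ _ _] := p2.
  exists (fun y z => powmix t s (rho2 y z) (rho1 y z)); split.
  - exact: pseudometric_powmix.
  - exact: weakly_dominated_powmix.
  apply/funext => j; rewrite /vec.
  rewrite (powR_normM _ _ (g1 _ _)) (powR_normM _ _ (g2 _ _)).
  rewrite (powR_normM _ _ (powmix_ge0 _ _ _ _)).
  by rewrite powmixK//; ring.
have EA v : E v -> \sum_j v j `^ (p / s) <= A `^ p + eta / 2.
  move=> [rho [prho drho ->]].
  have hrho := hA _ prho drho; rewrite lpnorm_fin_le// in hrho.
  apply: le_trans (lerD hrho meps).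
  rewrite -big_split/=; apply: ler_sum => j _.
  have th1 : 0 < p / s <= 1 by case/andP: th01 => -> /ltW.
  apply: le_trans (powR_subadd th1 (powR_ge0 _ _) (ltW eps0)) _.
  by rewrite lerD2r -powRrM mulrCA divff// mulr1.
have cE : 0 <= (D + eps) / eps.
  by rewrite divr_ge0// ?addr_ge0// ltW.
have [v Ev vE] := near_maximizer_weights th01 cE eta2 E0 Epos Ec Econv EA.
apply: (mixed_norm_le_weights (v := v)) => //.
- by move=> j; exact: Epos.
- apply: le_trans (EA _ Ev) _; rewrite lerD2l ler_pdivrMr//.
  by rewrite mulr_natr mulr2n lerDl ltW.
move=> f fB; have Ew : E (vec (fun y z => `|f y - f z|)).
  exists (fun y z => `|f y - f z|); split=> //.
    exact: pseudometric_lip.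
  exact: (weakly_dominated_lip s0e fB).
have := vE _ Ew; rewrite -addrA -splitr; apply: le_trans.
apply: ler_sum => j _; rewrite ler_wpM2l ?powR_ge0//.
by rewrite /vec [in leRHS]normrM normr_id -normrM lerDl ltW.
Qed.

(** With [s = +oo] the best factor is [tau_j = |sigma_j| d(y'_j, y''_j)], up to
    replacing its zeros by a small [eps]. *)
Lemma mixed_norm_le_dominated_infty (p A : R) m (sigma : 'I_m -> R)
    (y' y'' : 'I_m -> Y) :
  0 < p -> 0 <= A ->
  lpnorm p%:E (fun j => sigma j * mdist (y' j) (y'' j)) <= A ->
  (mixed_norm y0 +oo%E p%:E sigma y' y'' <= A%:E)%E.
Proof.
move=> p0 A0 hA; apply: (le_of_powR_approx p0 A0) => eta eta0.
have [eps eps0 meps] := small_powR_scale m p0 eta0.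
pose a j := `|sigma j * mdist (y' j) (y'' j)|.
pose tau j := if a j == 0 then eps else a j.
have tau0 j : 0 < tau j.
  by rewrite /tau; case: eqVneq => // aj; rewrite lt0r aj normr_ge0.
have taun j : tau j != 0 by rewrite gt_eqF.
have atau j : a j <= tau j.
  by rewrite /tau; case: eqVneq => // ->; exact: ltW.
apply: le_trans (mixed_norm_le y0 +oo%E p%:E sigma y' y'' taun) _.
rewrite mixed_conj_infty//.
have [W W0 WE] := weak_norm_fin y0 (fun j => sigma j / tau j) y' y'' (ltry 0).
have W1 : W <= 1.
  rewrite -lee_fin -WE; apply/weak_norm_leP => f /lip_dual_ballP[_ f1].
  apply/lpnorm_inftyP => // j.
  rewrite mulrAC normrM normfV (ger0_norm (ltW (tau0 j))) ler_pdivrMr// mul1r.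
  apply: le_trans (atau j); rewrite /a !normrM ler_wpM2l//.
  by rewrite [leRHS]ger0_norm ?mdist_ge0.
rewrite WE -EFinM lee_fin; apply: (@le_trans _ _ (lpnorm p%:E tau)).
  by rewrite ler_piMr ?lpnorm_ge0.
have B0 : 0 <= A `^ p + eta by rewrite addr_ge0 ?powR_ge0 ?ltW.
rewrite lpnorm_fin_le ?powR_ge0// (powR_rootK p0 B0).
rewrite lpnorm_fin_le// in hA; apply: le_trans (lerD hA meps).
rewrite -big_split/=; apply: ler_sum => j _.
rewrite (ger0_norm (ltW (tau0 j))) /tau; case: ifP => _.
  by rewrite lerDr powR_ge0.
by rewrite lerDl powR_ge0.
Qed.

(** The hard half of the duality. For [p = s] the mixed norm is the weak norm,
    a supremum over the pseudometrics [|f y - f z|]. *)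
Lemma mixed_norm_le_dominated (s p : \bar R) (A : R) m (sigma : 'I_m -> R)
    (y' y'' : 'I_m -> Y) :
  (1 <= s)%E -> (0 < p)%E -> (p <= s)%E -> 0 <= A ->
  (forall rho, pseudometric rho -> weakly_dominated y0 s rho ->
    lpnorm p (fun j => sigma j * rho (y' j) (y'' j)) <= A) ->
  (mixed_norm y0 s p sigma y' y'' <= A%:E)%E.
Proof.
move=> s1 p0 + A0; rewrite le_eqVlt => /predU1P[<-|ps] hA.
  rewrite mixed_norm_refl//; apply/weak_norm_leP => f fB.
  have := hA _ (pseudometric_lip f) (weakly_dominated_lip p0 fB).
  by apply: le_trans; apply: le_lpnorm => // j; rewrite !normrM normr_id.
case: p p0 ps hA => [p||]// p0 ps hA; last by rewrite ltNge leey in ps.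
rewrite lte_fin in p0.
case: s s1 ps hA => [s||]// s1 ps hA.
  by rewrite lee_fin in s1; exact: mixed_norm_le_dominated_fin.
apply: mixed_norm_le_dominated_infty => //; apply: hA.
  exact: pseudometric_mdist.
exact: mdist_weakly_dominated.
Qed.

End domination.

(** * Realizing pseudometrics by maps into Banach spaces *)

Section realization.
Context {R : realType} {Y : metricType R} (y0 : Y).

Lemma pseudometric_diff_le (rho : Y -> Y -> R) x y z : pseudometric rho ->
  `|rho x z - rho y z| <= rho x y.
Proof.
move=> [_ _ sym tri]; rewrite ler_norml lerNl opprB !lerBlDr tri andbT.
by rewrite (sym x y) tri.
Qed.

(** The Kuratowski maps [y |-> rho i y _ - rho i y0 _] of all [rho i] at once;
    the distance they induce is the supremum of the [rho i]. *)
Lemma kuratowski_family (I : Type) (rho : I -> Y -> Y -> R) :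
  (forall i, pseudometric (rho i)) ->
  (forall i y z, rho i y z <= mdist y z) ->
  exists (F : completeNormedModType R) (T : Y -> normed_metric F),
    (forall i y z, rho i y z <= mdist (T y) (T z)) /\
    (forall y z B, 0 <= B -> (forall i, rho i y z <= B) ->
      mdist (T y) (T z) <= B).
Proof.
move=> prho rho_le.
pose t y (iz : I * Y) : R^o := rho iz.1 y iz.2 - rho iz.1 y0 iz.2.
have tb y : t y \in @is_bounded R (I * Y)%type.
  apply/is_boundedP; exists (mdist y y0) => -[i z].
  by rewrite /t/= (le_trans (pseudometric_diff_le y y0 z (prho i))).
exists (bfun (I * Y) : completeNormedModType R), (fun y => BFun (tb y)).
have tE y z (iw : I * Y) : (BFun (tb y) - BFun (tb z)) iw =
    rho iw.1 y iw.2 - rho iw.1 z iw.2.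
  by rewrite /= /t opprB addrA subrK.
split=> [i y z|y z B B0 hB]; rewrite normed_metricE.
  have := bfun_norm_ub (BFun (tb y) - BFun (tb z)) (i, z).
  apply: le_trans; rewrite tE/=.
  by have [_ -> _ _] := prho i; rewrite subr0 ler_norm.
apply: bfun_norm_le => // -[i w]; rewrite tE/=.
exact: le_trans (pseudometric_diff_le y z w (prho i)) (hB i).
Qed.

Lemma summing_mixed_const1 (Z : metricType R) (s p : \bar R) (T : Y -> Z) :
  (0 < p)%E -> (p <= s)%E ->
  weakly_dominated y0 s (fun y z => mdist (T y) (T z)) ->
  summing_mixed_const y0 p s p T 1.
Proof.
move=> p0 ps hT; split=> // m sigma y' y''.
by rewrite mul1e; exact: (lpnorm_le_mixed_norm sigma y' y'' p0 ps hT).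
Qed.

Lemma summing_mixed_dominated (Z : metricType R) (s p : \bar R) (T : Y -> Z) :
  (0 < p)%E -> (p <= s)%E ->
  weakly_dominated y0 s (fun y z => mdist (T y) (T z)) ->
  summing_mixed y0 p s p T.
Proof.
move=> p0 ps hT; split; last by exists 1; exact: summing_mixed_const1.
exists 1; split=> // y z; rewrite mul1r.
exact: weakly_dominated_le (lt_le_trans p0 ps) hT y z.
Qed.

Lemma sum_half_pow n : \sum_(i < n) (2^-1 : R) ^+ i.+1 <= 1.
Proof.
suff -> : \sum_(i < n) (2^-1 : R) ^+ i.+1 = 1 - 2^-1 ^+ n.
  by rewrite gerBl exprn_ge0// invr_ge0.
elim: n => [|n IH]; first by rewrite big_ord0 expr0 subrr.
by rewrite big_ord_recr/= IH exprS; field.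
Qed.

(** The supremum [delta] of the pseudometrics [2 ^ (-(n+1)/s) * rho n] is weakly
    dominated, because [delta ^ s] is at most [\sum_n 2 ^ (-(n+1)) * rho n ^ s]
    and the weights sum to at most 1. *)
Lemma absorb_pseudometrics_fin (s : R) : 1 <= s ->
  exists2 K : nat -> R, (forall n, 0 <= K n) &
  forall rho : nat -> Y -> Y -> R,
  (forall n, pseudometric (rho n)) ->
  (forall n, weakly_dominated y0 s%:E (rho n)) ->
  exists (F : completeNormedModType R) (T : Y -> normed_metric F),
    weakly_dominated y0 s%:E (fun y z => mdist (T y) (T z)) /\
    forall n y z, rho n y z <= K n * mdist (T y) (T z).
Proof.
move=> s1; have s0 : 0 < s := lt_le_trans ltr01 s1.
have s0e : (0 < s%:E)%E by [].
pose w n : R := 2^-1 ^+ n.+1.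
have w0 n : 0 < w n by rewrite exprn_gt0.
have w1 n : w n <= 1 by rewrite exprn_ile1// ?invr_ge0// invf_le1// ler1n.
pose c n := w n `^ s^-1.
have c0 n : 0 < c n by rewrite powR_gt0.
have c1 n : c n <= 1.
  by rewrite powR_root_le ?(ltW (w0 n))// powR1.
have cs n : c n `^ s = w n by exact: powR_rootK s0 (ltW (w0 n)).
exists (fun n => (c n)^-1) => [n|rho prho drho]; first by rewrite invr_ge0 ltW.
pose rho' n y z := c n * rho n y z.
have rho0 n y z : 0 <= rho n y z by case: (prho n).
have prho' n : pseudometric (rho' n).
  have [_ xx sym tri] := prho n; split=> [y z|y|y z|x y z].
  - by rewrite mulr_ge0// ltW.
  - by rewrite /rho' xx mulr0.
  - by rewrite /rho' sym.
  - by rewrite /rho' -mulrDr ler_wpM2l// ltW.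
have rho'_le n y z : rho' n y z <= mdist y z.
  apply: le_trans (weakly_dominated_le s0e (drho n) y z).
  by rewrite ler_piMl.
have [F [T [Tge Tle]]] := kuratowski_family prho' rho'_le.
exists F, T; split; last by move=> n y z; rewrite mulrC ler_pdivlMr// mulrC Tge.
have d0 y z : 0 <= mdist (T y) (T z) by exact: mdist_ge0.
have approx y z (e : R) : 0 < e ->
    exists n, mdist (T y) (T z) `^ s <= w n * rho n y z `^ s + e.
  move=> e0; apply: contrapT => /forallNP h.
  have {}h n : w n * rho n y z `^ s + e < mdist (T y) (T z) `^ s.
    by rewrite ltNge; apply/negP/h.
  have lb n : w n * rho n y z `^ s <= mdist (T y) (T z) `^ s - e.
    by rewrite lerBrDr ltW.
  have D0 : 0 <= mdist (T y) (T z) `^ s - e.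
    by apply: le_trans (lb 0); rewrite mulr_ge0 ?powR_ge0// ltW.
  have : mdist (T y) (T z) <= (mdist (T y) (T z) `^ s - e) `^ s^-1.
    apply: Tle => [|n]; first exact: powR_ge0.
    rewrite le_powR_root ?mulr_ge0 ?(ltW (c0 n))//.
    by rewrite powRM ?(ltW (c0 n))// cs.
  by rewrite le_powR_root// lerBrDr gerDl leNgt e0.
move=> m sigma y' y''.
have [W W0 WE] := weak_norm_fin y0 sigma y' y'' s0e.
rewrite WE lee_fin lpnorm_fin_le//; apply/ler_addgt0Pr => e e0.
pose S := \sum_j `|sigma j| `^ s.
have S0 : 0 <= S by apply: sumr_ge0 => j _; exact: powR_ge0.
have S1 : 0 < S + 1 by rewrite ltr_wpDl.
have eS : 0 < e / (S + 1) by rewrite divr_gt0.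
have [n hn] := choice (fun j => approx (y' j) (y'' j) _ eS).
pose N := (\max_(j < m) n j).+1.
have nN j : (n j < N)%N by rewrite ltnS; exact: (leq_bigmax j).
have stepj j : `|sigma j * mdist (T (y' j)) (T (y'' j))| `^ s <=
    \sum_(k < N) w k * `|sigma j * rho k (y' j) (y'' j)| `^ s +
    `|sigma j| `^ s * (e / (S + 1)).
  rewrite powR_normM//.
  apply: le_trans (ler_wpM2l (powR_ge0 _ _) (hn j)) _.
  rewrite mulrDr lerD2r (bigD1 (Ordinal (nN j)))//= powR_normM// mulrCA lerDl.
  by apply: sumr_ge0 => k _; rewrite mulr_ge0 ?powR_ge0// ltW.
apply: le_trans (ler_sum _ (fun j _ => stepj j)) _.
rewrite big_split/= -mulr_suml exchange_big/=; apply: lerD; last first.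
  rewrite mulrCA ler_piMr ?(ltW e0)// ler_pdivrMr// mul1r.
  by rewrite lerDl.
apply: (@le_trans _ _ (\sum_(k < N) w k * W `^ s)).
  apply: ler_sum => k _; rewrite -mulr_sumr ler_wpM2l ?(ltW (w0 k))//.
  by rewrite -lpnorm_fin_le// -lee_fin -WE; exact: drho.
by rewrite -mulr_suml ler_piMl ?powR_ge0// sum_half_pow.
Qed.

Lemma absorb_pseudometrics_infty :
  exists2 K : nat -> R, (forall n, 0 <= K n) &
  forall rho : nat -> Y -> Y -> R,
  (forall n, pseudometric (rho n)) ->
  (forall n, weakly_dominated y0 +oo%E (rho n)) ->
  exists (F : completeNormedModType R) (T : Y -> normed_metric F),
    weakly_dominated y0 +oo%E (fun y z => mdist (T y) (T z)) /\
    forall n y z, rho n y z <= K n * mdist (T y) (T z).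
Proof.
exists (fun=> 1) => // rho prho drho.
have rho_le n := weakly_dominated_le (ltry 0) (drho n).
have [F [T [Tge Tle]]] := kuratowski_family prho rho_le.
exists F, T; split; last by move=> n y z; rewrite mul1r.
move=> m sigma y' y''.
apply: le_trans (mdist_weakly_dominated y0 sigma y' y''); rewrite lee_fin.
apply: le_lpnorm => // j; rewrite !normrM ler_wpM2l//.
rewrite !ger0_norm ?mdist_ge0//.
by apply: Tle => //; exact: mdist_ge0.
Qed.

(** The constants [K n] are fixed before the sequence of pseudometrics is
    chosen; the gliding hump picks [rho n] depending on [K n]. *)
Lemma absorb_pseudometrics (s : \bar R) : (1 <= s)%E ->
  exists2 K : nat -> R, (forall n, 0 <= K n) &
  forall rho : nat -> Y -> Y -> R,
  (forall n, pseudometric (rho n)) ->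
  (forall n, weakly_dominated y0 s (rho n)) ->
  exists (F : completeNormedModType R) (T : Y -> normed_metric F),
    weakly_dominated y0 s (fun y z => mdist (T y) (T z)) /\
    forall n y z, rho n y z <= K n * mdist (T y) (T z).
Proof.
case: s => [s||]// s1; first exact: absorb_pseudometrics_fin.
exact: absorb_pseudometrics_infty.
Qed.

Lemma realize_pseudometric (s : \bar R) (rho : Y -> Y -> R) : (0 < s)%E ->
  pseudometric rho -> weakly_dominated y0 s rho ->
  exists (F : completeNormedModType R) (T : Y -> normed_metric F),
    forall y z, mdist (T y) (T z) = rho y z.
Proof.
move=> s0 prho drho.
have [F [T [Tge Tle]]] := kuratowski_family (fun _ : unit => prho)
  (fun _ : unit => weakly_dominated_le s0 drho).
exists F, T => y z; apply/eqP; rewrite eq_le (Tge tt) andbT.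
by apply: Tle => //; case: prho.
Qed.

End realization.

(** * The quotient formula *)

Section quotient.
Context {R : realType} {X Y : metricType R} (x0 : X) (y0 : Y).
Context (s p r : \bar R).
Context (hs : (1 <= s)%E) (hp : (0 < p)%E) (hps : (p <= s)%E) (hr : (0 < r)%E).

(** The infimum defining the norm is attained: for fixed sequences the
    inequality is closed in the constant, mixed norms being finite. *)
Lemma summing_mixed_const_closed (Z W : metricType R) (z0 : Z) (u v q : \bar R)
    (T : Z -> W) (b : R) : (0 < v)%E ->
  (summing_mixed_norm z0 u v q T <= b%:E)%E -> summing_mixed_const z0 u v q T b.
Proof.
move=> v0 hb; split.
  rewrite -lee_fin; apply: le_trans hb.
  by apply: le_ereal_inf_tmp => _ [C [C0 _] <-]; rewrite lee_fin.
move=> m sigma z' z''; have [M M0 ME] := mixed_norm_fin z0 q sigma z' z'' v0.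
rewrite ME /strong_norm -EFinM lee_fin; apply/ler_addgt0Pr => e e0.
have M1 : 0 < M + 1 by rewrite ltr_wpDl.
have : (summing_mixed_norm z0 u v q T < (b + e / (M + 1))%:E)%E.
  by apply: le_lt_trans hb _; rewrite lte_fin ltrDl divr_gt0.
move=> /ereal_inf_lt[_ [C [C0 hC] <-]]; rewrite lte_fin => /ltW Cb.
have := hC m sigma z' z''; rewrite ME /strong_norm -EFinM lee_fin => h.
apply: le_trans h _; apply: le_trans (ler_wpM2r M0 Cb) _.
rewrite mulrDl lerD2l mulrAC ler_pdivrMr// ler_wpM2l ?(ltW e0)//.
by rewrite lerDl.
Qed.

Definition bounds_pseudometrics (S : X -> Y) (C : R) := 0 <= C /\
  forall rho, pseudometric rho -> weakly_dominated y0 s rho ->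
  forall m (sigma : 'I_m -> R) (x' x'' : 'I_m -> X),
    ((lpnorm p (fun j => sigma j * rho (S (x' j)) (S (x'' j))))%:E <=
     C%:E * weak_norm x0 r sigma x' x'')%E.

Lemma mixed_summing_const_bounds S C : bounds_pseudometrics S C ->
  mixed_summing_const x0 y0 s p r S C.
Proof.
move=> [C0 hC]; split=> // m sigma x' x''.
have [W W0 WE] := weak_norm_fin x0 sigma x' x'' hr.
rewrite WE -EFinM; apply: mixed_norm_le_dominated => //.
  exact: mulr_ge0.
by move=> rho prho drho; rewrite -lee_fin EFinM -WE; exact: hC.
Qed.

Lemma summing_mixed_const_comp S C (Z : metricType R) (T : Y -> Z) :
  mixed_summing_const x0 y0 s p r S C -> summing_mixed_const y0 p s p T 1 ->
  summing_mixed_const x0 p r r (T \o S) C.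
Proof.
move=> [C0 hC] [_ hT]; split=> // m sigma x' x''.
rewrite mixed_norm_refl//; apply: le_trans (hC _ _ _ _).
by have := hT m sigma (S \o x') (S \o x''); rewrite mul1e.
Qed.

(** Gliding hump: a map absorbing pseudometrics that violate the bounds
    [K n * n] has a composite with [S] that is summing with some constant [C],
    which contradicts the choice of the [n]-th one as soon as [C <= n]. *)
Lemma bounds_pseudometrics_exists (S : X -> Y) :
  (forall (F : completeNormedModType R) (T : Y -> normed_metric F),
     summing_mixed y0 p s p T -> summing_mixed x0 p r r (T \o S)) ->
  exists C, bounds_pseudometrics S C.
Proof.
move=> hTS; apply: contrapT => /forallNP h.
have [K K0 hK] := absorb_pseudometrics y0 hs.
have bad n : exists rho, [/\ pseudometric rho, weakly_dominated y0 s rho &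
    ~ forall m (sigma : 'I_m -> R) (x' x'' : 'I_m -> X),
    ((lpnorm p (fun j => sigma j * rho (S (x' j)) (S (x'' j))))%:E <=
     (K n * n%:R)%:E * weak_norm x0 r sigma x' x'')%E].
  apply: contrapT => /forallNP hn; apply: (h (K n * n%:R)).
  split=> [|rho prho drho]; first by rewrite mulr_ge0.
  by apply: contrapT => hrho; apply: (hn rho).
have [rho hrho] := choice bad.
have [F [T [dT hT]]] := hK rho (fun n => let: And3 a _ _ := hrho n in a)
  (fun n => let: And3 _ a _ := hrho n in a).
have [_ [C [C0 hC]]] := hTS F T (summing_mixed_dominated hp hps dT).
have [n Cn] : exists n : nat, C <= n%:R.
  by exists (Num.bound C); rewrite ltW// archi_boundP.
case: (hrho n) => prho drho; apply => m sigma x' x''.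
have := hC m sigma x' x''; rewrite mixed_norm_refl//.
have [W W0 WE] := weak_norm_fin x0 sigma x' x'' hr.
rewrite WE /strong_norm -!EFinM !lee_fin => hn.
have hn' := le_trans hn (ler_wpM2r W0 Cn).
rewrite -mulrA; apply: le_trans (ler_wpM2l (K0 n) hn').
apply: le_trans (lpnormZ_le _ hp (K0 n)).
have [rho0 _ _ _] := prho.
apply: le_lpnorm => // j; rewrite mulrCA !normrM ler_wpM2l//.
rewrite (ger0_norm (rho0 _ _)) (ger0_norm (K0 n)) (ger0_norm (mdist_ge0 _ _)).
exact: hT.
Qed.

End quotient.

Local Open Scope ereal_scope.

Theorem theorem4p12 (R : realType) (X Y : metricType R) (x0 : X) (y0 : Y)
    (s p r : \bar R)
    (hs : 1 <= s) (hp : 0 < p) (hps : p <= s) (hr : 0 < r) (hrp : r <= p)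
    (S : X -> Y) (hS : lipschitz_map S)
    (hTS : forall (F : completeNormedModType R) (T : Y -> normed_metric F),
       summing_mixed y0 p s p T -> summing_mixed x0 p r r (T \o S)) :
  mixed_summing x0 y0 s p r S /\
  mixed_summing_norm x0 y0 s p r S =
    ereal_sup [set v : \bar R |
      exists (F : completeNormedModType R) (T : Y -> normed_metric F),
        [/\ summing_mixed y0 p s p T, summing_mixed_norm y0 p s p T <= 1
          & v = summing_mixed_norm x0 p r r (T \o S)]].
Proof.
have s0 : 0 < s := lt_le_trans hp hps.
split.
  split=> //; have [C hC] := bounds_pseudometrics_exists hs hp hps hr hTS.
  by exists C; exact: (mixed_summing_const_bounds hs hp hps hr hC).
apply/eqP; rewrite eq_le; apply/andP; split; last first.
  apply: ge_ereal_sup => _ [F [T [_ T1 ->]]].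
  have T1' := summing_mixed_const_closed s0 T1.
  apply: le_ereal_inf_tmp => _ [C hC <-]; apply: ereal_inf_lbound.
  by exists C => //; exact: (summing_mixed_const_comp hr hC T1').
set U := ereal_sup _.
(* every weakly dominated pseudometric is the distance of an admissible [T] *)
have single rho : pseudometric rho -> weakly_dominated y0 s rho ->
    exists (F : completeNormedModType R) (T : Y -> normed_metric F),
      (forall y z, mdist (T y) (T z) = rho y z) /\
      summing_mixed_norm x0 p r r (T \o S) <= U.
  move=> prho drho; have [F [T TE]] := realize_pseudometric s0 prho drho.
  have dT : weakly_dominated y0 s (fun y z => mdist (T y) (T z)).
    by rewrite (_ : (fun y z => _) = rho)//; apply/funext => y; apply/funext.
  exists F, T; split=> //; apply: ereal_sup_ubound; exists F, T; split=> //.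
    exact: summing_mixed_dominated.
  apply: ereal_inf_lbound; exists 1%R => //; exact: summing_mixed_const1.
have U0 : 0 <= U.
  have [F [T [_ TU]]] := single _ (pseudometric_lip (fun=> 0%R))
    (weakly_dominated_lip s0 (zero_lip_dual_ball y0)).
  apply: le_trans TU.
  by apply: le_ereal_inf_tmp => _ [C [C0 _] <-]; rewrite lee_fin.
case UE : U U0 => [b||]// b0; last by rewrite leey.
apply: ereal_inf_lbound; exists b => //.
apply: mixed_summing_const_bounds => //; split=> // rho prho drho m sigma x' x''.
have [F [T [TE]]] := single rho prho drho; rewrite UE => Tb.
have [_ /(_ m sigma x' x'')] := summing_mixed_const_closed hr Tb.
rewrite mixed_norm_refl// /strong_norm.
by under eq_fun do rewrite /= TE.
Qed.
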